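(* There exists a constant $C>0$ depending only on $m$ and $\beta$ such that for every compact convex set $K\subset\mathbb{R}^d$, every probability measure $\mu\in\mathcal{M}_K$ and all nonempty closed domains $F,G\subset K$, $$\sup_{x,y\in K}\left|D_{\mu,F}(x,y)-D_{\mu,G}(x,y)\right|\le C\,\mathrm{diam}(K)^{\beta+\frac12}\sqrt{d_H(F,G)},$$ where $d_H(F,G)=\max\left(\sup_{x\in F}d(x,G),\ \sup_{x\in G}d(x,F)\right)$ is the Hausdorff distance.
   Context: $\mathbb{R}^d$ carries the Euclidean norm $\|\cdot\|$; $B(x,r)$ is the open ball; $d(x,G)=\inf_{z\in G}\|x-z\|$. Fixed real parameters: $m\in(0,1]$, $p\ge 1$, $\beta\ge 1$. For a probability measure $\mu$ on $\mathbb{R}^d$, $\delta_{\mu,u}(x)=\inf\{r>0:\mu(B(x,r))>u\}$ and the distance-to-measure is $d_\mu(x)=\left(\frac1m\int_0^m\delta_{\mu,u}(x)^p\,du\right)^{1/p}$. $\mathcal{M}_K$ is the set of probability measures on $\mathbb{R}^d$ with support included in $K$. A rectifiable path is a continuous $\gamma:[0,1]\to\mathbb{R}^d$ of finite Euclidean length $|\gamma|=\int_0^1\|\dot\gamma(t)\|\,dt$, parametrized so as to be Lipschitz (always possible, e.g. with constant speed). Its FDTM length is $D_\mu(\gamma)=\int_0^1 d_\mu(\gamma(t))^\beta\|\dot\gamma(t)\|\,dt$. For a closed set $F\subset\mathbb{R}^d$ (the domain) and $x,y\in\mathbb{R}^d$, $\Gamma_F(x,y)$ is the set of rectifiable paths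 $\gamma$ with $\gamma(0)=x$, $\gamma(1)=y$ such that for every open interval $I\subset[0,1]$ with $\gamma(I)\subset\mathbb{R}^d\setminus F$ there is a unit vector $u\in\mathbb{R}^d$ with $\dot\gamma(t)=\|\dot\gamma(t)\|u$ for all $t\in I$ where $\dot\gamma$ is defined. The Fermat distance-to-measure is $D_{\mu,F}(x,y)=\inf_{\gamma\in\Gamma_F(x,y)}D_\mu(\gamma)$. *)

(* Defs.v *)
From HB Require Import structures.
From mathcomp Require Import all_boot all_order all_algebra.
From mathcomp Require Import all_classical all_reals all_analysis.
Set Implicit Arguments.
Unset Strict Implicit.
Unset Printing Implicit Defensive.
Import Order.TTheory GRing.Theory Num.Theory.
Import numFieldNormedType.Exports.
Local Open Scope classical_set_scope.
Local Open Scope ring_scope.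

(* The library norm on 'rV[R]_d is the sup norm. It induces the same topology
   as the Euclidean norm, so compact, closed, continuous and derivable are
   the library notions, but all metric quantities below use enorm. *)
Definition enorm (R : realType) (d : nat) (x : 'rV[R]_d) : R :=
  Num.sqrt (\sum_(i < d) x ord0 i ^+ 2).

Definition eball (R : realType) (d : nat) (x : 'rV[R]_d) (r : R)
  : set 'rV[R]_d := [set y | enorm (y - x) < r].

(* In the next three definitions, sup and inf in R return 0 on sets that are
   empty or not suitably bounded; this does not occur for nonempty sets
   included in a compact set. *)
Definition diam (R : realType) (d : nat) (K : set 'rV[R]_d) : R :=
  sup [set enorm (x - y) | x in K & y in K].

Definition dist_to (R : realType) (d : nat) (x : 'rV[R]_d)
  (G : set 'rV[R]_d) : R := inf [set enorm (x - z) | z in G].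

Definition hausdorff_dist (R : realType) (d : nat) (F G : set 'rV[R]_d) : R :=
  Num.max (sup [set dist_to x G | x in F]) (sup [set dist_to x F | x in G]).

(* R^d with its Borel sigma-algebra *)
Definition borel_rV (R : realType) (d : nat) :=
  g_sigma_algebraType (@open 'rV[R]_d).

Definition measure_support (R : realType) (d : nat)
  (mu : probability (borel_rV R d) R) : set 'rV[R]_d :=
  [set x | forall r : R, 0 < r -> (0 < mu (eball x r))%E].

(* Values in \bar R, so that the infimum over the empty set is +oo (which
   happens for u = 1). *)
Definition delta_mu (R : realType) (d : nat)
  (mu : probability (borel_rV R d) R) (u : R) (x : 'rV[R]_d) : \bar R :=
  ereal_inf [set r%:E | r in [set r : R | 0 < r /\ (u%:E < mu (eball x r))%E]].

Definition dtm (R : realType) (m p : R) (d : nat)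
  (mu : probability (borel_rV R d) R) (x : 'rV[R]_d) : \bar R :=
  (((m^-1)%:E *
    \int[lebesgue_measure]_(u in `[0%R, m]) (delta_mu mu u x `^ p)) `^ p^-1)%E.

(* A path is a function on R of which only the restriction to [0, 1] matters.
   For Lipschitz gamma the points where it is not derivable (where derive1 is
   a default value) are negligible, as are the endpoints 0 and 1. *)
Definition path_length (R : realType) (d : nat) (gamma : R -> 'rV[R]_d)
  : \bar R :=
  (\int[lebesgue_measure]_(t in `[0%R, 1%R]) (enorm (derive1 gamma t))%:E)%E.

Definition rectifiable_path (R : realType) (d : nat) (gamma : R -> 'rV[R]_d)
  : Prop :=
  [/\ {within `[0, 1], continuous gamma},
      (exists k : R, forall s t : R, s \in `[0, 1] -> t \in `[0, 1] ->
         enorm (gamma s - gamma t) <= k * `|s - t|)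
    & (path_length gamma < +oo)%E].

Definition fdtm_length (R : realType) (m p beta : R) (d : nat)
  (mu : probability (borel_rV R d) R) (gamma : R -> 'rV[R]_d) : \bar R :=
  (\int[lebesgue_measure]_(t in `[0%R, 1%R])
     ((dtm m p mu (gamma t)) `^ beta * (enorm (derive1 gamma t))%:E))%E.

(* Adding the endpoints 0 or 1 to an interval would not change the condition:
   a one-sided derivative there has the direction u of the open segment. *)
Definition straight_outside (R : realType) (d : nat) (F : set 'rV[R]_d)
  (gamma : R -> 'rV[R]_d) : Prop :=
  forall a b : R, 0 <= a -> a < b -> b <= 1 ->
    (forall t : R, t \in `]a, b[ -> ~ F (gamma t)) ->
    exists u : 'rV[R]_d, enorm u = 1 /\
      forall t : R, t \in `]a, b[ -> derivable gamma t 1 ->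
        derive1 gamma t = enorm (derive1 gamma t) *: u.

Definition Gamma_paths (R : realType) (d : nat) (F : set 'rV[R]_d)
  (x y : 'rV[R]_d) : set (R -> 'rV[R]_d) :=
  [set gamma | [/\ rectifiable_path gamma, gamma 0 = x, gamma 1 = y
                 & straight_outside F gamma]].

Definition fermat_dtm (R : realType) (m p beta : R) (d : nat)
  (mu : probability (borel_rV R d) R) (F : set 'rV[R]_d)
  (x y : 'rV[R]_d) : \bar R :=
  ereal_inf [set fdtm_length m p beta mu gamma | gamma in Gamma_paths F x y].

(* Main.v *)
Require Import Defs.
From HB Require Import structures.
From mathcomp Require Import all_boot all_order all_algebra.
From mathcomp Require Import all_classical all_reals all_analysis.
From mathcomp Require Import ring lra.
From mathcomp Require Import measurable_realfun.
Import Order.TTheory GRing.Theory Num.Theory.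
Import numFieldNormedType.Exports.
Local Open Scope classical_set_scope.
Local Open Scope ring_scope.

(** The distance to measure g is nonnegative, 1-Lipschitz, and small only near
    few points: g x < r forces a ball of radius 2 r about x to have mass at
    least m / 2, so that at most 2 / m points at mutual distance at least 4 r
    can have g < r (dtmr_packing). The record tame_weight collects these
    properties. They are all that is needed of the measure, which is why the
    constant depends on m and beta only.

    For x and y in K the Fermat distance from x to y is the infimum of the costs
    of the polygons from x to y with intermediate vertices in F (here: chains),
    the cost of a segment being the integral of g ^ beta along it. A polygon is
    an admissible path (polygon_Gamma). Conversely an admissible path is cut at
    well chosen times at which it is in F: between two such times it is either
    short, so that g is almost constant and the chord is not longer, or outside
    F, hence straight (path_link). This uses the differentiability
    almost everywhere of Lipschitz functions and the fundamental theorem of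
    calculus for them (lipschitz_ftc).

    It remains to turn a polygon with vertices in F into one with vertices in G
    at distance at most e of the former (chain_transfer). Moving one segment
    changes its cost by O(D ^ beta * e), where D is the diameter of K, so the
    number of segments must be controlled.

    - After taking every shortcut that lowers the cost, the polygon has length
      O(D) (optimal_length). Indeed a segment of length l cannot lie entirely
      in the region where g is much smaller than l, so its mean density a is
      at least of the order of l. Consider the segments of density between
      r / 2 and r. Those that start in a ball of radius O(r) are parts of a
      polygonal arc which a segment of cost O(r ^ (beta + 1)) could replace,
      and each of them costs at least (r / 2) ^ beta per unit of length: their
      total length is O(r). By the packing property O(1 / m) balls of radius
      O(r) cover the starts of all of them. The sum over r = D, D / 2, ... is
      geometric.
    - Replacing arcs of length at most h by their chords leaves O(D / h)
      segments, and increases the cost by O(D ^ (beta - 1) * h) per unit of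
      length, hence by O(D ^ beta * h) in total (coarsen).

    The total loss O(D ^ beta * (h + (D / h) * e)) is smallest for
    h = sqrt (D * e), where it is O(D ^ (beta + 1 / 2) * sqrt e). *)

(** * Euclidean norm *)

Section euclidean_norm.
Context {R : realType} {d : nat}.
Implicit Types x y z : 'rV[R]_d.

Definition dotv x y : R := \sum_(i < d) x ord0 i * y ord0 i.

Lemma enorm_sqr x : enorm x ^+ 2 = dotv x x.
Proof.
rewrite /enorm sqr_sqrtr; last by apply: sumr_ge0 => i _; exact: sqr_ge0.
by apply: eq_bigr => i _; rewrite expr2.
Qed.

Lemma enorm_ge0 x : 0 <= enorm x.
Proof. exact: sqrtr_ge0. Qed.

Lemma dotvC x y : dotv x y = dotv y x.
Proof. by apply: eq_bigr => i _; rewrite mulrC. Qed.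

Lemma dotvDl x y z : dotv (x + y) z = dotv x z + dotv y z.
Proof.
by rewrite -big_split; apply: eq_bigr => i _; rewrite mxE mulrDl.
Qed.

Lemma dotvZl a x y : dotv (a *: x) y = a * dotv x y.
Proof.
by rewrite mulr_sumr; apply: eq_bigr => i _; rewrite mxE mulrA.
Qed.

Lemma dotvv_ge0 x : 0 <= dotv x x.
Proof. by rewrite -enorm_sqr sqr_ge0. Qed.

Lemma enorm0 : enorm (0 : 'rV[R]_d) = 0.
Proof.
by rewrite /enorm big1 ?sqrtr0// => i _; rewrite mxE expr0n.
Qed.

Lemma coord_le_enorm x i : `|x ord0 i| <= enorm x.
Proof.
rewrite -(ler_pXn2r (n := 2))// ?nnegrE ?enorm_ge0//.
rewrite enorm_sqr real_normK ?num_real// /dotv (bigD1 i)//= -expr2 lerDl.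
by apply: sumr_ge0 => j _; rewrite -expr2 sqr_ge0.
Qed.

Lemma enorm_eq0 x : enorm x = 0 -> x = 0.
Proof.
move=> x0; apply/rowP => i; rewrite mxE; apply/eqP.
by rewrite -normr_le0 -x0 coord_le_enorm.
Qed.

Lemma enormZ a x : enorm (a *: x) = `|a| * enorm x.
Proof.
apply/eqP; rewrite -(eqrXn2 (n := 2)) ?mulr_ge0 ?enorm_ge0//.
rewrite exprMn !enorm_sqr dotvZl dotvC dotvZl mulrA -expr2.
by rewrite real_normK ?num_real.
Qed.

Lemma enormN x : enorm (- x) = enorm x.
Proof. by rewrite -scaleN1r enormZ normrN1 mul1r. Qed.

Lemma enormC x y : enorm (x - y) = enorm (y - x).
Proof. by rewrite -opprB enormN. Qed.

(** Cauchy-Schwarz, by expanding the square of |y| x - |x| y. *)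
Lemma dotv_le x y : dotv x y <= enorm x * enorm y.
Proof.
have [y0|y0] := eqVneq (enorm y) 0.
  rewrite (enorm_eq0 _ y0) dotvC -[0 as X in dotv X](scale0r 0) dotvZl mul0r.
  by rewrite mulr_ge0// enorm_ge0.
have [x0|x0] := eqVneq (enorm x) 0.
  rewrite (enorm_eq0 _ x0) -[0 as X in dotv X](scale0r 0) dotvZl mul0r.
  by rewrite mulr_ge0// enorm_ge0.
have xgt0 : 0 < enorm x by rewrite lt_neqAle eq_sym x0 enorm_ge0.
have ygt0 : 0 < enorm y by rewrite lt_neqAle eq_sym y0 enorm_ge0.
have := dotvv_ge0 (enorm y *: x - enorm x *: y).
rewrite -scaleNr dotvDl !(dotvZl, dotvC _ (_ + _), dotvDl) (dotvC y x).
rewrite -!enorm_sqr.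
set a := enorm x in xgt0 *; set b := enorm y in ygt0 *; set c := dotv x y.
have -> : b * (b * a ^+ 2 + - a * c) + - a * (b * c + - a * b ^+ 2) =
  2 * (a * b) * (a * b - c) by ring.
by rewrite pmulr_rge0 ?subr_ge0// !mulr_gt0.
Qed.

Lemma ler_enormD x y : enorm (x + y) <= enorm x + enorm y.
Proof.
rewrite -(ler_pXn2r (n := 2))// ?nnegrE ?addr_ge0 ?enorm_ge0//.
rewrite enorm_sqr dotvDl !(dotvC _ (x + y)) !dotvDl (dotvC y x) sqrrD.
rewrite -!enorm_sqr; have := dotv_le x y; lra.
Qed.

Lemma enorm_triangle y x z : enorm (x - z) <= enorm (x - y) + enorm (y - z).
Proof. by rewrite -{1}(subrK y x) -addrA ler_enormD. Qed.

Lemma enorm_sum (n : nat) (x : nat -> 'rV[R]_d) :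
  enorm (\sum_(i < n) x i) <= \sum_(i < n) enorm (x i).
Proof.
elim: n => [|n IH]; first by rewrite !big_ord0 enorm0.
by rewrite !big_ord_recr/= (le_trans (ler_enormD _ _))// lerD2r.
Qed.

Lemma mx_norm_le_enorm x : `|x| <= enorm x.
Proof.
rewrite [leLHS]/Num.Def.normr/= mx_normrE bigmax_le ?enorm_ge0// => -[i j] _ /=.
by rewrite (ord1 i) coord_le_enorm.
Qed.

Lemma enorm_le_mx_norm x : enorm x <= Num.sqrt d%:R * `|x|.
Proof.
rewrite -(ler_pXn2r (n := 2))// ?nnegrE ?mulr_ge0 ?enorm_ge0 ?sqrtr_ge0//.
rewrite enorm_sqr exprMn sqr_sqrtr// /dotv.
rewrite (@le_trans _ _ (\sum_(i < d) `|x| ^+ 2))//; last first.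
  by rewrite sumr_const card_ord mulr_natl.
apply: ler_sum => i _; rewrite -expr2 -(real_normK (num_real (x ord0 i))).
rewrite ler_pXn2r ?nnegrE//.
rewrite [leRHS]/Num.Def.normr/= mx_normrE.
exact: (le_bigmax _ (fun ij => `|x ij.1 ij.2|) (ord0, i)).
Qed.

(** An estimate of Lipschitz type in the Euclidean norm gives continuity for
    the topology of 'rV[R]_d, which is defined by the equivalent sup norm. *)
Lemma enorm_lip_continuous (f : 'rV[R]_d -> R) :
  (forall x y, f x <= f y + enorm (x - y)) -> continuous f.
Proof.
move=> fl x; apply/(@cvgrPdist_lt _ _ _ (nbhs x)) => e e0.
have c0 : 0 < Num.sqrt d%:R + 1 :> R by rewrite ltr_wpDl ?sqrtr_ge0.
near=> y.
have fxy : `|f x - f y| <= enorm (x - y).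
  by rewrite ler_norml; have := fl x y; have := fl y x; rewrite (enormC y x); lra.
rewrite (le_lt_trans fxy)// (le_lt_trans (enorm_le_mx_norm _))//.
rewrite (@le_lt_trans _ _ ((Num.sqrt d%:R + 1) * `|x - y|))//.
  by rewrite ler_wpM2r// lerDl.
rewrite mulrC -ltr_pdivlMr//; near: y.
by apply: (@cvgr_dist_lt _ _ _ (nbhs x) _ id) => //; rewrite divr_gt0.
Unshelve. all: by end_near. Qed.

Lemma enorm_continuous : continuous (@enorm R d).
Proof.
apply: enorm_lip_continuous => x y.
by have := ler_enormD (x - y) y; rewrite subrK addrC.
Qed.

Lemma eball_open x (r : R) : open (eball x r).
Proof.
rewrite (_ : eball x r = (fun y => enorm (y - x)) @^-1` [set t | t < r])//.
apply: open_comp; last exact: open_lt.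
move=> y _; apply: (@continuous_comp _ _ _ (fun y => y - x) (@enorm R d)).
  by apply: (@continuousD _ _ _ id (cst (- x))); [exact: cvg_id|exact: cst_continuous].
exact: enorm_continuous.
Qed.

Lemma unit_vector_exists x : x != 0 -> exists u : 'rV[R]_d, enorm u = 1.
Proof.
move=> x0; exists ((enorm x)^-1 *: x).
have e0 : enorm x != 0 by apply: contra_neq x0 => /enorm_eq0.
by rewrite enormZ ger0_norm ?invr_ge0 ?enorm_ge0// mulVf.
Qed.

End euclidean_norm.

(** * Lipschitz functions on an interval *)

Section lipschitz_ftc.
Context {R : realType}.
Local Notation mu := (@lebesgue_measure R).

Lemma stieltjes_itv (g : cumulative R R) (a b : R) : a <= b ->
  lebesgue_stieltjes_measure g `]a, b] = (g b - g a)%:E.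
Proof.
move=> ab; rewrite /lebesgue_stieltjes_measure /measure_extension/=.
rewrite measurable_mu_extE/=; last exact: is_ocitv.
by rewrite wlength_itv_bnd// EFinB.
Qed.

(** Used to dominate the Stieltjes measure of g by the Lebesgue measure. *)
Lemma stieltjes_add (g h : cumulative R R) (c : {nonneg R}) :
  (forall x, g x + h x = c%:num * x) -> forall A, measurable A ->
  (lebesgue_stieltjes_measure g A + lebesgue_stieltjes_measure h A =
   c%:num%:E * mu A)%E.
Proof.
move=> gh A mA.
have cnd : {homo (fun x : R => c%:num * x) : x y / x <= y}.
  by move=> x y xy; rewrite ler_wpM2l.
have crc : right_continuous (fun x : R => c%:num * x).
  by apply/right_continuousW => x; apply: cvgM; [exact: cvg_cst|exact: cvg_id].
pose C : cumulative R R := HB.pack (fun x : R => c%:num * x)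
  (isCumulative.Build R _ R (fun x : R => c%:num * x) cnd crc).
transitivity (lebesgue_stieltjes_measure C A).
  rewrite -measure_addE; apply/esym.
  apply: (lebesgue_stieltjes_measure_unique (mu := measure_add _ _)) => //.
  move=> X /ocitvP[->|[[a b]/= ab ->]]; first by rewrite !measure0.
  rewrite [RHS]measure_addE stieltjes_itv ?ltW//=.
  rewrite [X in (_ = X + _)%E]stieltjes_itv ?ltW//.
  rewrite [X in (_ = _ + X)%E]stieltjes_itv ?ltW//.
  by rewrite -EFinD -2!gh; congr EFin; ring.
apply: (lebesgue_stieltjes_measure_unique (mu := mscale c mu)) => //.
move=> X /ocitvP[->|[[a b]/= ab ->]]; first by rewrite !measure0.
rewrite stieltjes_itv ?ltW//= /mscale /= lebesgue_measure_itv/= lte_fin ab.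
by rewrite -EFinD -EFinM mulrBr.
Qed.

(** Both f t + k t and k t - f t are nondecreasing and their sum is 2 k t, so
    the Stieltjes measure of the former has a density with respect to the
    Lebesgue measure. By Lebesgue differentiation that density is the
    derivative of f t + k t almost everywhere; rho is the density minus k.
    Outside [a, b] the function f is first replaced by its value at the nearest
    endpoint, which keeps it Lipschitz. *)
Lemma lipschitz_ftc (f : R -> R) (k a b : R) : a <= b ->
  (forall s t, a <= s <= b -> a <= t <= b -> `|f s - f t| <= k * `|s - t|) ->
  exists rho : R -> R, [/\ mu.-integrable [set: R] (EFin \o rho),
    forall s t, a <= s -> s <= t -> t <= b ->
      f t - f s = (\int[mu]_(x in `[s, t]) rho x)%R &
    {ae mu, forall t, a < t < b -> derivable f t 1 /\ derive1 f t = rho t}].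
Proof.
move=> ab flip.
pose cl (t : R) := Num.max a (Num.min b t).
have clE t : a <= t <= b -> cl t = t.
  by move=> /andP[at_ tb]; rewrite /cl min_r// max_r.
have clab t : a <= cl t <= b.
  by rewrite /cl le_max lexx/= ge_max ab ge_min lexx.
have clnd s t : s <= t -> 0 <= cl t - cl s <= t - s.
  move=> st; rewrite /cl; case: (leP b t) => ?; case: (leP b s) => ?;
    do !case: (leP a _) => ?; apply/andP; split; lra.
pose F t := f (cl t).
have Flip s t : s <= t -> `|F t - F s| <= `|k| * (t - s).
  move=> st; rewrite (le_trans (flip _ _ (clab _) (clab _)))//.
  have /andP[c0 c1] := clnd _ _ st; rewrite ger0_norm//.
  by rewrite (le_trans (ler_wpM2r c0 (ler_norm k)))// ler_wpM2l.
pose G t := F t + `|k| * t.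
pose H t := `|k| * t - F t.
have Gnd : {homo G : x y / x <= y}.
  move=> x y xy; rewrite /G.
  by have := Flip _ _ xy; rewrite ler_norml => /andP[]; rewrite mulrBr; lra.
have Hnd : {homo H : x y / x <= y}.
  move=> x y xy; rewrite /H.
  by have := Flip _ _ xy; rewrite ler_norml => /andP[]; rewrite mulrBr; lra.
have Fc : continuous F.
  move=> x; apply/cvgrPdist_lt => e e0.
  have k1 : 0 < `|k| + 1 by rewrite ltr_wpDl.
  near=> y.
  have Fxy : `|F x - F y| <= `|k| * `|x - y|.
    have [xy|/ltW yx] := leP x y.
      by rewrite distrC (distrC x) (ger0_norm (_ : 0 <= y - x)) ?subr_ge0// Flip.
    by rewrite (ger0_norm (_ : 0 <= x - y)) ?subr_ge0// Flip.
  rewrite (le_lt_trans Fxy)// (@le_lt_trans _ _ ((`|k| + 1) * `|x - y|))//.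
    by rewrite ler_wpM2r// lerDl.
  rewrite mulrC -ltr_pdivlMr//; near: y.
  by apply: (@cvgr_dist_lt _ _ _ (nbhs x) _ id) => //; rewrite divr_gt0.
have kc : continuous (fun t : R => `|k| * t).
  by move=> x; apply: cvgM; [exact: cvg_cst|exact: cvg_id].
have Grc : right_continuous G.
  by apply/right_continuousW => x; apply: cvgD; [exact: Fc|exact: kc].
have Hrc : right_continuous H.
  by apply/right_continuousW => x; apply: cvgB; [exact: kc|exact: Fc].
pose G' : cumulative R R := HB.pack G (isCumulative.Build R _ R G Gnd Grc).
pose H' : cumulative R R := HB.pack H (isCumulative.Build R _ R H Hnd Hrc).
have k2 : 0 <= 2 * `|k| by rewrite mulr_ge0.
have GHmu := @stieltjes_add G' H' (NngNum k2) _.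
have {}GHmu A : measurable A -> (lebesgue_stieltjes_measure G' A +
  lebesgue_stieltjes_measure H' A = (2 * `|k|)%:E * mu A)%E.
  by move=> mA; apply: GHmu => // x /=; rewrite /G /H; ring.
have Goo : (lebesgue_stieltjes_measure G' `]a, b] < +oo)%E.
  by rewrite stieltjes_itv// ltry.
have mab : measurable (`]a, b] : set (measurableTypeR R)).
  exact: measurable_itv.
pose nu := mfrestr mab Goo.
have numu : nu `<< mu.
  apply/null_content_dominatesP => A mA A0; apply/eqP.
  rewrite eq_le measure_ge0 andbT.
  have := GHmu _ mA; rewrite A0 mule0 => GH0.
  rewrite /nu /mfrestr /mrestr.
  rewrite (@le_trans _ _ (lebesgue_stieltjes_measure G' A))//.
    by apply: le_measure; rewrite ?inE//; exact: measurableI.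
  by rewrite -GH0 leeDl.
have [f0 [f0_ge0 f0fin if0 nuE]] :=
  @radon_nikodym_sigma_finite _ _ _ mu nu numu.
pose r0 : R -> R := fun x => fine (f0 x).
have ir0 : mu.-integrable [set: R] (EFin \o r0).
  by apply: eq_integrable if0 => //= x _; rewrite /r0 fineK.
pose h : R -> R := (cst `|k|) \_ `[a, b].
have ih : mu.-integrable [set: R] (EFin \o h).
  rewrite (_ : EFin \o h = (EFin \o cst `|k|) \_ `[a, b]); last first.
    by rewrite restrict_EFin.
  apply/(@integrable_mkcond _ _ _ mu _ _ (measurable_itv _)).
  apply: continuous_compact_integrable; first exact: segment_compact.
  by apply: continuous_subspaceT => x; exact: cvg_cst.
pose rho : R -> R := fun x => r0 x - h x.
have irho : mu.-integrable [set: R] (EFin \o rho).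
  exact: (integrableB measurableT ir0 ih).
have sub (D : set R) : measurable D -> forall g : R -> R,
    mu.-integrable [set: R] (EFin \o g) -> mu.-integrable D (EFin \o g).
  by move=> mD g ig; apply: integrableS ig.
have rhoE s t : a <= s -> s <= t -> t <= b ->
    f t - f s = (\int[mu]_(x in `[s, t]) rho x)%R.
  move=> as_ st tb.
  have mst : measurable (`[s, t] : set R) by exact: measurable_itv.
  rewrite /rho RintegralB; [|exact: measurable_itv|by apply: sub|by apply: sub].
  have -> : (\int[mu]_(x in `[s, t]) h x)%R = `|k| * (t - s).
    rewrite (@eq_Rintegral _ _ _ _ _ (cst `|k|)).
      rewrite Rintegral_cst//= lebesgue_measure_itv/= lte_fin.
      by move: st; rewrite le_eqVlt => /predU1P[->|->]//=; rewrite ltxx subrr.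
    move=> x; rewrite inE/= in_itv/= => /andP[sx xt].
    by rewrite /h patchE mem_set//= in_itv/= (le_trans as_ sx) (le_trans xt).
  rewrite -Rintegral_itv_obnd_cbnd; last by apply: sub.
  have : nu `]s, t]%classic = (G t - G s)%:E.
    rewrite /nu /mfrestr /mrestr /= setIidl ?stieltjes_itv//.
    move=> x /=; rewrite !in_itv/= => /andP[sx xt].
    by rewrite (le_lt_trans as_ sx) (le_trans xt).
  move=> /(etrans (esym (nuE _ (measurable_itv `]s, t])))).
  have -> : f0 = EFin \o r0 by apply/funext => x; rewrite /r0 /= fineK.
  move=> nuG; rewrite /Rintegral [X in fine X](_ : _ = (G t - G s)%:E)//=.
  rewrite /G /F !clE; first by ring.
    by rewrite as_ (le_trans st).
  by rewrite (le_trans as_ st).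
exists rho; split => //.
have := FTC1Ny (fun y => sub _ (measurable_itv `]-oo, y]) _ irho)
  (open_integrable_locally openT irho).
apply: filterS; first exact: (ae_filter_ringOfSetsType mu).
move=> x + /andP[ax xb].
set P := (fun x => _); move=> [dP Px].
have nearE : \near x, P x + (f a - P a) = f x.
  near=> y.
  have ya : a < y by near: y; exact: lt_nbhsr.
  have yb : y < b by near: y; exact: lt_nbhsl.
  have := @Rintegral_itvB _ rho -oo%O (BRight y) a
    (sub _ (measurable_itv `]-oo, y]) _ irho).
  rewrite /= !bnd_simp (ltW ya) => /(_ isT isT).
  rewrite Rintegral_itv_obnd_cbnd; last by apply: sub => //; exact: measurable_itv.
  rewrite -(rhoE a y (lexx a) (ltW ya) (ltW yb)) -/(P y) -/(P a) => /eqP; rewrite subr_eq => /eqP ->.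
  by lra.
have dc : is_derive (x : R^o) 1 (P + cst (f a - P a)) (rho x + 0).
  apply: is_deriveD.
  by rewrite -Px derive1E; exact/derivableP.
by have [] := near_eq_is_derive nearE dc; rewrite addr0 derive1E.
Unshelve. all: by end_near. Qed.

End lipschitz_ftc.

(** * Diameter and support *)

Section diameter.
Context {R : realType} {d : nat} (K : set 'rV[R]_d).
Hypothesis K_compact : compact K.

Lemma compact_enorm_bounded :
  exists B, forall x y, K x -> K y -> enorm (x - y) <= B.
Proof.
have [M [_ KM]] := compact_bounded K_compact.
exists (Num.sqrt d%:R * ((`|M| + 1) + (`|M| + 1))) => x y Kx Ky.
rewrite (le_trans (enorm_le_mx_norm _))// ler_wpM2l ?sqrtr_ge0//.
have M1 : M < `|M| + 1 by rewrite (le_lt_trans (ler_norm _))// ltrDl.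
by rewrite (le_trans (ler_normB _ _))// lerD// (KM _ M1).
Qed.

Lemma le_diam x y : K x -> K y -> enorm (x - y) <= diam K.
Proof.
move=> Kx Ky; apply: ub_le_sup; last by exists x => //; exists y.
have [B KB] := compact_enorm_bounded.
by exists B => _ [s Ks [t Kt <-]]; exact: KB.
Qed.

Lemma diam_ge0 : 0 <= diam K.
Proof.
have [K0|/set0P[x Kx]] := eqVneq K set0; last first.
  by rewrite (le_trans (enorm_ge0 (x - x)))// le_diam.
rewrite /diam K0 (_ : [set _ | _ in _ & _ in _] = set0) ?sup0//.
by apply/seteqP; split => // z [x []].
Qed.

End diameter.

Section null_complement.
Context {R : realType} {d : nat}.

Lemma rat_vector_dense (x : 'rV[R]_d) (e : R) : 0 < e ->
  exists q : 'rV[rat]_d, enorm (map_mx ratr q - x) < e.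
Proof.
move=> e0; pose c : R := Num.sqrt d%:R + 1.
have c0 : 0 < c by rewrite ltr_wpDl ?sqrtr_ge0.
have ec0 : 0 < e / c by rewrite divr_gt0.
have qP i : exists q : rat, ratr q \in `]x ord0 i - e / c, x ord0 i + e / c[.
  by apply: rat_in_itvoo; lra.
exists (\row_i sval (cid (qP i))).
rewrite (le_lt_trans (enorm_le_mx_norm _))//.
rewrite (@le_lt_trans _ _ (Num.sqrt d%:R * (e / c)))//.
  rewrite ler_wpM2l ?sqrtr_ge0//.
  rewrite [leLHS]/Num.Def.normr/= mx_normrE bigmax_le ?ltW// => -[i j] _ /=.
  rewrite (ord1 i) !mxE; case: cid => q /=; rewrite in_itv/= => qx.
  by rewrite ltW// ltr_norml; lra.
rewrite mulrCA gtr_pMr// ltr_pdivrMr// mul1r /c; lra.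
Qed.

Lemma eball_measurable (x : 'rV[R]_d) r :
  measurable (eball x r : set (borel_rV R d)).
Proof. by apply: sub_sigma_algebra; exact: eball_open. Qed.

(** The complement of the support is a union of null balls; by separability
    it is a countable one. *)
Lemma support_complement_null (mu : probability (borel_rV R d) R)
  (K : set 'rV[R]_d) : closed K -> measure_support mu `<=` K -> mu (~` K) = 0%E.
Proof.
move=> Kcl sK.
pose E (qk : 'rV[rat]_d * nat) : set (borel_rV R d) :=
  let B := eball (map_mx ratr qk.1) qk.2.+1%:R^-1 in
  if mu B == 0%E then B else set0.
pose F n := if unpickle n is Some qk then E qk else set0.
have Fnull : mu.-negligible (\bigcup_n F n).
  apply: negligible_bigcup => n; rewrite /F; case: unpickle => [qk|]; last first.
    exact: negligible_set0.
  rewrite /E; case: ifPn => [/eqP mu0|_]; last exact: negligible_set0.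
  by apply/negligibleP => //; exact: eball_measurable.
have mKc : measurable (~` K : set (borel_rV R d)).
  by apply: measurableC; rewrite -[X in measurable X]setCK;
    apply: measurableC; apply: sub_sigma_algebra; exact: closed_openC.
apply/negligibleP => //; apply: negligibleS Fnull => y Ky.
have : ~ measure_support mu y by move=> /sK.
move=> /existsNP[r /not_implyP[r0 /negP]]; rewrite -leNgt => mur.
have [k kr] : exists k : nat, k.+1%:R^-1 < r / 2.
  have r2 : 0 < r / 2 by rewrite divr_gt0.
  have [k _ /(_ k (leqnn k)) kr] := near_infty_natSinv_lt (PosNum r2).
  by exists k.
have k0 : 0 < k.+1%:R^-1 :> R by rewrite invr_gt0.
have [q qy] := rat_vector_dense y _ k0.
exists (pickle (q, k)) => //; rewrite /F pickleK /E /=.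
rewrite ifT; first by rewrite /eball/= enormC.
rewrite eq_le measure_ge0 andbT (le_trans _ mur)//.
apply: le_measure; rewrite ?inE; [exact: eball_measurable..|].
move=> z; rewrite /eball/= => zq.
rewrite (le_lt_trans (enorm_triangle (map_mx ratr q) _ _))//.
by rewrite (splitr r) (lt_trans (ltrD zq qy))// ltrD.
Qed.

End null_complement.

(** * Distance to measure *)

Section dtm_theory.
Context {R : realType} {d : nat} (m p : R).
Context (mu : probability (borel_rV R d) R) (K : set 'rV[R]_d).
Hypotheses (m_gt0 : 0 < m) (m_le1 : m <= 1) (p_ge1 : 1 <= p).
Hypotheses (K_compact : compact K) (supp_K : measure_support mu `<=` K).
Hypothesis K_neq0 : K !=set0.
Local Notation leb := (@lebesgue_measure R).

Lemma eball_subset_mu1 x r : K `<=` eball x r -> mu (eball x r) = 1%E.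
Proof.
move=> Kr; apply/eqP; rewrite eq_le probability_le1/=; last exact: eball_measurable.
have Kcl : closed K by apply: compact_closed => //; exact: norm_hausdorff.
have mK : measurable (K : set (borel_rV R d)).
  by rewrite -[X in measurable X]setCK; apply: measurableC;
    apply: sub_sigma_algebra; exact: closed_openC.
have <- : mu K = 1%E.
  rewrite (_ : (1 = 1 - mu (~` K))%E); last by rewrite support_complement_null// sube0.
  by rewrite -probability_setC ?setCK//; exact: measurableC.
by apply: le_measure => //; rewrite inE//; exact: eball_measurable.
Qed.

Lemma delta_le u x r : 0 < r -> (u%:E < mu (eball x r))%E ->
  (delta_mu mu u x <= r%:E)%E.
Proof. by move=> r0 ur; apply: ereal_inf_lbound; exists r. Qed.

Lemma delta_ge0 u x : (0 <= delta_mu mu u x)%E.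
Proof. by apply: le_ereal_inf_tmp => _ [r [r0 _] <-]; rewrite lee_fin ltW. Qed.

Lemma delta_nd u v x : u <= v -> (delta_mu mu u x <= delta_mu mu v x)%E.
Proof.
move=> uv; apply: ereal_inf_le_tmp => _ [r [r0 vr] <-]; exists r => //; split => //.
by rewrite (le_lt_trans _ vr)// lee_fin.
Qed.

Lemma delta_lip u x y :
  (delta_mu mu u x <= delta_mu mu u y + (enorm (x - y))%:E)%E.
Proof.
rewrite -leeBlDr//; apply: le_ereal_inf_tmp => _ [r [r0 ur] <-].
rewrite leeBlDr// -EFinD; apply: delta_le; first by rewrite ltr_wpDr ?enorm_ge0.
rewrite (lt_le_trans ur)//; apply: le_measure; rewrite ?inE;
  [exact: eball_measurable..|].
move=> z; rewrite /eball/= => zy.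
by rewrite (le_lt_trans (enorm_triangle y _ _))// (enormC y x) ltrD2r.
Qed.

Lemma delta_bounded x : exists2 B, 0 <= B &
  forall u, u < 1 -> (delta_mu mu u x <= B%:E)%E.
Proof.
have [x0 Kx0] := K_neq0.
have B0 : 0 < diam K + 1 + enorm (x0 - x).
  by rewrite ltr_wpDr ?enorm_ge0// ltr_wpDl ?diam_ge0.
exists (diam K + 1 + enorm (x0 - x)); first exact: ltW.
move=> u u1; apply: delta_le => //.
rewrite eball_subset_mu1 ?lte_fin// => z Kz; rewrite /eball/=.
rewrite (le_lt_trans (enorm_triangle x0 _ _))// ltrD2r.
by rewrite (le_lt_trans (le_diam _ K_compact z x0 Kz Kx0))// ltrDl.
Qed.

Lemma delta_le_diam u x : K x -> u < 1 -> (delta_mu mu u x <= (diam K)%:E)%E.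
Proof.
move=> Kx u1; apply/lee_addgt0Pr => e e0; rewrite -EFinD.
apply: delta_le; first by rewrite ltr_wpDl ?diam_ge0.
rewrite eball_subset_mu1 ?lte_fin// => z Kz; rewrite /eball/=.
by rewrite (le_lt_trans (le_diam _ K_compact z x Kz Kx))// ltrDl.
Qed.

(** For u >= 1 the infimum may range over the empty set and be infinite; the
    truncation at a bound valid for all u < 1 makes it real. *)
Lemma delta_real x : exists f : R -> R, [/\ nondecreasing_fun f,
  forall u, 0 <= f u & forall u, u < 1 -> delta_mu mu u x = (f u)%:E].
Proof.
have [B B0 xB] := delta_bounded x.
have fin u : mine (delta_mu mu u x) B%:E \is a fin_num.
  apply/fin_numPlt; rewrite (@lt_le_trans _ _ 0%E) ?ltNyr//=; last first.
    by rewrite le_min delta_ge0 lee_fin.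
  by rewrite gt_min ltry orbT.
exists (fun u => fine (mine (delta_mu mu u x) B%:E)); split.
- move=> u v uv; rewrite fine_le// le_min ge_min delta_nd//=.
  by rewrite ge_min lexx orbT.
- by move=> u; rewrite fine_ge0// le_min delta_ge0 lee_fin.
- by move=> u u1; rewrite fineK// min_l// xB.
Qed.

(** The L^p norm of f for the uniform probability measure on [0, m). *)
Definition meanp (f : R -> R) : \bar R :=
  ((m^-1%:E * \int[leb]_(u in `[0%R, m[) (f u `^ p)%:E) `^ p^-1)%E.

Lemma p_gt0 : 0 < p. Proof. exact: lt_le_trans p_ge1. Qed.

(** The integral ignores the endpoint u = m, which may be 1. *)
Lemma dtm_meanp x f : nondecreasing_fun f ->
  (forall u, u < 1 -> delta_mu mu u x = (f u)%:E) ->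
  dtm m p mu x = meanp f.
Proof.
move=> fnd fE; rewrite /dtm /meanp; congr ((_ * _) `^ _)%E.
have eqD : {in `[0, m[%classic, (fun u => (delta_mu mu u x `^ p)%E) =1
    (fun u => (f u `^ p)%:E)}.
  move=> u; rewrite inE/= in_itv/= => /andP[_ um].
  by rewrite fE ?(lt_le_trans um)// poweR_EFin.
have mf : measurable_fun `[0, m[%classic (EFin \o (fun u => f u `^ p)).
  apply/measurable_EFinP; apply: (measurableT_comp (measurable_powR _)).
  exact: nondecreasing_measurable.
rewrite -integral_itv_bndo_bndc; first exact: eq_integral.
by apply: eq_measurable_fun mf => u uD; rewrite eqD.
Qed.

Lemma meanp_le (f g : R -> R) : measurable_fun [set: R] f -> measurable_fun [set: R] g ->
  (forall u, 0 <= u < m -> 0 <= f u <= g u) -> (meanp f <= meanp g)%E.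
Proof.
move=> mf mg fg; rewrite /meanp.
have m0 : (0 <= (m^-1)%:E)%E by rewrite lee_fin invr_ge0 ltW.
have i0 (h : R -> R) : (0 <= \int[leb]_(u in `[0%R, m[) (h u `^ p)%:E)%E.
  by apply: integral_ge0 => u _; rewrite lee_fin powR_ge0.
have mp (h : R -> R) : measurable_fun [set: R] h ->
    measurable_fun `[0, m[%classic (EFin \o (fun u => h u `^ p)).
  move=> mh; apply/measurable_EFinP.
  apply: (measurableT_comp (measurable_powR _)).
  exact: measurable_funTS.
have pV0 : 0 <= p^-1 by rewrite invr_ge0 (ltW p_gt0).
apply: (gt0_ler_poweR pV0).
- by rewrite in_itv/= leey (mule_ge0 m0 (i0 f)).
- by rewrite in_itv/= leey (mule_ge0 m0 (i0 g)).
apply: (lee_wpmul2l m0); apply: ge0_le_integral => //.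
- by move=> u _; rewrite lee_fin powR_ge0.
- exact: mp.
- exact: mp.
- move=> u; rewrite /= in_itv/= => /fg /andP[f0 fu].
  by rewrite lee_fin ge0_ler_powR ?nnegrE ?(ltW p_gt0)// (le_trans f0).
Qed.

Lemma meanp_cst (c : R) : 0 <= c -> meanp (cst c) = c%:E.
Proof.
move=> c0; rewrite /meanp (eq_integral (cst (c `^ p)%:E))// integral_cst//=.
rewrite lebesgue_measure_itv/= lte_fin m_gt0.
rewrite -EFinB -!EFinM poweR_EFin subr0 mulrCA mulVf ?gt_eqF// mulr1.
by rewrite -powRrM mulfV ?gt_eqF ?p_gt0// powRr1.
Qed.

Lemma meanp_minkowski (f : R -> R) (c : R) : measurable_fun [set: R] f ->
  (forall u, 0 <= f u) -> 0 <= c ->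
  (meanp (fun u => f u + c)%R <= meanp f + c%:E)%E.
Proof.
move=> mf f0 c0.
have p0 := p_gt0.
have m0 : (0 <= (m^-1)%:E)%E by rewrite lee_fin invr_ge0 ltW.
pose D : set R := `[0, m[%classic.
have mD : measurable D by exact: measurable_itv.
have normE (h : R -> R) : (forall u, 0 <= h u) ->
    meanp h = ((m^-1%:E `^ p^-1) * 'N[leb]_p%:E[EFin \o (h \_ D)])%E.
  move=> h0; rewrite /meanp poweRM//; last first.
    by apply: integral_ge0 => u _; rewrite lee_fin powR_ge0.
  rewrite Lnorm.unlock; apply: (congr1 (fun t => _ * t `^ _)%E).
  rewrite [LHS]integral_mkcond; apply: eq_integral => u _ /=.
  rewrite !patchE; case: ifPn => _; first by rewrite ger0_norm// poweR_EFin.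
  change (0%E = (`|0 : R| `^ p)%:E).
  by rewrite normr0 powR0// gt_eqF.
rewrite -(meanp_cst c c0) !normE//; last by move=> u; rewrite addr_ge0.
rewrite -muleDr; last 2 first.
- by rewrite poweR_EFin.
- by rewrite ge0_adde_def// inE Lnorm_ge0.
apply: lee_wpmul2l; first exact: poweR_ge0.
have -> : EFin \o ((fun u => f u + c) \_ D) =
    (EFin \o ((f \_ D) \+ ((cst c) \_ D))).
  apply/funext => u /=; rewrite !patchE; case: ifPn => //= _.
  by rewrite addr0.
have mr (h : R -> R) :
    measurable_fun [set: R] h -> measurable_fun [set: R] (h \_ D).
  by move=> mh; apply: (measurable_restrictT _ _).1 => //; exact: measurable_funTS.
by apply: minkowski_EFin => //; exact: mr.
Qed.

Definition dtmr x : R := fine (dtm m p mu x).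

Lemma dtm_le (B : R) x : 0 <= B -> (forall u, u < 1 -> (delta_mu mu u x <= B%:E)%E) ->
  (dtm m p mu x <= B%:E)%E.
Proof.
move=> B0 xB; have [f [fnd f0 fE]] := delta_real x.
rewrite (dtm_meanp _ _ fnd fE) -(meanp_cst _ B0) meanp_le//.
  exact: nondecreasing_measurable.
move=> u /andP[_ um]; rewrite f0/= -lee_fin -fE ?xB//; exact: lt_le_trans m_le1.
Qed.

Lemma dtm_fin x : dtm m p mu x = (dtmr x)%:E.
Proof.
have [B B0 xB] := delta_bounded x.
rewrite /dtmr fineK// ge0_fin_numE ?poweR_ge0//.
by rewrite (le_lt_trans (dtm_le _ _ B0 xB))// ltry.
Qed.

Lemma dtmr_ge0 x : 0 <= dtmr x.
Proof. by rewrite -lee_fin -dtm_fin poweR_ge0. Qed.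

Lemma dtmr_le_diam x : K x -> dtmr x <= diam K.
Proof.
move=> Kx; rewrite -lee_fin -dtm_fin dtm_le ?diam_ge0// => u u1.
exact: delta_le_diam.
Qed.

(** Each delta_u is 1-Lipschitz, and the mean is a norm that fixes constants. *)
Lemma dtmr_lip x y : dtmr x <= dtmr y + enorm (x - y).
Proof.
have [f [fnd f0 fE]] := delta_real x; have [g [gnd g0 gE]] := delta_real y.
suff : (dtm m p mu x <= dtm m p mu y + (enorm (x - y))%:E)%E.
  rewrite (dtm_fin x) (dtm_fin y); move: (dtmr x) (dtmr y) => a b.
  by rewrite -EFinD lee_fin.
rewrite (dtm_meanp x f fnd fE) (dtm_meanp y g gnd gE).
have mg : measurable_fun [set: R] g by exact: nondecreasing_measurable.
apply: le_trans (meanp_minkowski g _ mg g0 (enorm_ge0 (x - y))).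
apply: meanp_le; first exact: nondecreasing_measurable.
  exact: measurable_funD.
move=> u /andP[_ um]; have u1 : u < 1 := lt_le_trans um m_le1.
by rewrite f0/= -lee_fin EFinD -fE// -gE// delta_lip.
Qed.

(** Half of the mass m contributes at least delta_(m/2) to the mean, so a small
    distance to measure forces a ball of comparable radius to carry m/2. *)
Lemma dtmr_small_mass x r : 0 < r -> dtmr x < r ->
  ((m / 2)%:E <= mu (eball x (2 * r)))%E.
Proof.
move=> r0; apply: contraPT; rewrite -ltNge => mux; apply/negP; rewrite -leNgt.
have p0 := p_gt0.
have [f [fnd f0 fE]] := delta_real x.
have m20 : 0 < m / 2 by rewrite divr_gt0.
have m2m : m / 2 < m by rewrite ltr_pdivrMr// ltr_pMr// ltr1n.
have m21 : m / 2 < 1 := lt_le_trans m2m m_le1.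
have f2 u : m / 2 <= u -> 2 * r <= f u.
  move=> mu_; rewrite (le_trans _ (fnd _ _ mu_))// -lee_fin -fE//.
  apply: le_ereal_inf_tmp => _ [s [s0 ms] <-]; rewrite lee_fin leNgt.
  apply/negP => sr; move: (lt_trans mux ms); apply/negP; rewrite -leNgt.
  apply: le_measure; rewrite ?inE; [exact: eball_measurable..|].
  by move=> z; rewrite /eball/= => /lt_trans; exact.
rewrite -lee_fin -dtm_fin (dtm_meanp _ _ fnd fE) /meanp.
have rE : r%:E = ((r `^ p)%:E `^ p^-1)%E.
  by rewrite poweR_EFin -powRrM mulfV ?gt_eqF// powRr1// ltW.
have i0 (h : R -> R) : (0 <= \int[leb]_(u in `[0%R, m[) (h u `^ p)%:E)%E.
  by apply: integral_ge0 => u _; rewrite lee_fin powR_ge0.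
have pV0 : 0 <= p^-1 by rewrite invr_ge0 ltW.
rewrite rE; apply: (gt0_ler_poweR pV0).
- by rewrite in_itv/= leey lee_fin powR_ge0.
- by rewrite in_itv/= leey mule_ge0 ?i0// lee_fin invr_ge0 ltW.
have mf : measurable_fun [set: R] (EFin \o (fun u => f u `^ p)).
  apply/measurable_EFinP; apply: (measurableT_comp (measurable_powR _)).
  exact: nondecreasing_measurable.
apply: (@le_trans _ _
    ((m^-1)%:E * \int[leb]_(u in `[(m / 2)%R, m[) ((2 * r) `^ p)%:E)%E).
  rewrite integral_cst//= lebesgue_measure_itv/= lte_fin m2m -EFinB -!EFinM.
  rewrite lee_fin powRM ?(ltW r0)//.
  have -> : m^-1 * (2 `^ p * r `^ p * (m - m / 2)) = 2 `^ p / 2 * r `^ p.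
    by field; rewrite gt_eqF.
  rewrite ler_peMl ?powR_ge0// ler_pdivlMr// mul1r.
  by rewrite -[leLHS](@powRr1 _ 2)// ler_powR// ler1n.
apply: lee_wpmul2l; first by rewrite lee_fin invr_ge0 ltW.
apply: (@le_trans _ _ (\int[leb]_(u in `[(m / 2)%R, m[) (f u `^ p)%:E)%E).
  apply: ge0_le_integral => //.
  - by move=> u _; rewrite lee_fin powR_ge0.
  - exact: measurable_funTS.
  - move=> u; rewrite /= in_itv/= => /andP[mu_ _]; have := f2 _ mu_.
    by move=> fu; rewrite lee_fin ge0_ler_powR ?nnegrE ?(ltW p0) ?f0 ?mulr_ge0 ?(ltW r0).
apply: ge0_subset_integral => //.
- exact: measurable_funTS.
- by move=> u _; rewrite lee_fin powR_ge0.
- by move=> u /=; rewrite !in_itv/= => /andP[mu_ ->]; rewrite (le_trans (ltW m20)).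
Qed.

(** Points that are far apart have disjoint balls, and the mass is one. *)
Lemma dtmr_packing (n : nat) (z : 'I_n -> 'rV[R]_d) (r : R) : 0 < r ->
  (forall i, dtmr (z i) < r) ->
  (forall i j, i != j -> 4 * r <= enorm (z i - z j)) ->
  n%:R * (m / 2) <= 1.
Proof.
move=> r0 zr zd.
pose B i := eball (z i) (2 * r) : set (borel_rV R d).
have mB i : measurable (B i) by exact: eball_measurable.
have tB : trivIset [set: 'I_n] B.
  apply/trivIsetP => i j _ _ ij; apply/seteqP; split => // w [].
  rewrite /B /eball/= => wi wj; have := zd _ _ ij; apply/negP; rewrite -ltNge.
  rewrite (le_lt_trans (enorm_triangle (w : 'rV[R]_d) _ _))// (enormC _ w).
  by rewrite (lt_le_trans (ltrD wi wj))//; lra.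
have := @measure_bigsetU_ord _ _ _ mu n xpredT B mB tB.
move=> muE; rewrite -lee_fin.
rewrite (@le_trans _ _ (\sum_(i < n) mu (B i))%E)//; last first.
  by rewrite -muE probability_le1//; exact: bigsetU_measurable.
rewrite (@le_trans _ _ (\sum_(i < n) (m / 2)%:E)%E)//; last first.
  by apply: lee_sum => i _; exact: dtmr_small_mass.
by rewrite sumEFin lee_fin sumr_const card_ord mulr_natl.
Qed.

End dtm_theory.

(** * Powers and integrals over intervals *)

Section power_tangent.
Context {R : realType}.

(** Convexity of t |-> t ^ b, in the form of Young's inequality for the
    conjugate exponents b and b / (b - 1). *)
Lemma powR_tangent (b x y : R) : 1 <= b -> 0 <= x -> 0 <= y ->
  y `^ b - x `^ b <= b * y `^ (b - 1) * (y - x).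
Proof.
rewrite le_eqVlt => /predU1P[<-|b1] x0 y0.
  by rewrite !powRr1// subrr powRr0 !mul1r.
have b0 : 0 < b by lra.
have b10 : 0 < b - 1 by lra.
have yb : y `^ b = y * y `^ (b - 1).
  have nz : (1 + (b - 1) == 0) ==> (y != 0) by rewrite addrC subrK gt_eqF.
  by have := powRD nz; rewrite (powRr1 y0) => <-; rewrite addrC subrK.
have := @conjugate_powR R x (y `^ (b - 1)) b (b / (b - 1)) x0 (powR_ge0 _ _) b0.
rewrite divr_gt0// invf_div => /(_ isT) young.
have : b^-1 + (b - 1) / b = 1 by field; rewrite gt_eqF.
have e : (b - 1) * (b / (b - 1)) = b by field; rewrite gt_eqF.
move=> /young; rewrite -powRrM e.
rewrite -(ler_pM2l b0) => {}young.
have E : b * (x `^ b / b + y `^ b * ((b - 1) / b)) = x `^ b + (b - 1) * y `^ b.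
  by field; rewrite gt_eqF.
by move: young; rewrite E yb; lra.
Qed.

Lemma powR_le_add (b x y e M : R) : 1 <= b -> 0 <= x -> 0 <= y -> 0 <= e ->
  y <= x + e -> y <= M -> y `^ b <= x `^ b + b * M `^ (b - 1) * e.
Proof.
move=> b1 x0 y0 e0 yxe yM.
have b0 : 0 <= b by lra.
have M0 : 0 <= M := le_trans y0 yM.
have c0 : 0 <= b * M `^ (b - 1) by rewrite mulr_ge0 ?powR_ge0.
have [xy|/ltW yx] := leP x y; last first.
  have : y `^ b <= x `^ b by rewrite ge0_ler_powR.
  have : 0 <= b * M `^ (b - 1) * e by rewrite mulr_ge0.
  lra.
have := powR_tangent b x y b1 x0 y0.
have yMb : y `^ (b - 1) <= M `^ (b - 1).
  by rewrite ge0_ler_powR ?nnegrE// subr_ge0.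
have : b * y `^ (b - 1) * (y - x) <= b * M `^ (b - 1) * e.
  rewrite ler_pM ?mulr_ge0 ?powR_ge0 ?subr_ge0//; last lra.
  by rewrite ler_wpM2l.
lra.
Qed.

End power_tangent.

Section affine_integral.
Context {R : realType}.
Local Notation leb := (@lebesgue_measure R).

Lemma continuous_integrable_itv (f : R -> R) (a b : R) : continuous f ->
  leb.-integrable `[a, b] (EFin \o f).
Proof.
move=> cf; apply: continuous_compact_integrable; first exact: segment_compact.
exact: continuous_subspaceT.
Qed.

Lemma Rintegral_itv_split (f : R -> R) (a b c : R) : continuous f ->
  a <= b -> b <= c ->
  \int[leb]_(x in `[a, c]) f x =
  \int[leb]_(x in `[a, b]) f x + \int[leb]_(x in `[b, c]) f x.
Proof.
move=> cf ab bc.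
have := @Rintegral_itvB R f (BLeft a) (BRight c) b (continuous_integrable_itv _ _ _ cf).
rewrite !bnd_simp => /(_ ab bc).
rewrite Rintegral_itv_obnd_cbnd => [/eqP|].
  by rewrite subr_eq addrC => /eqP.
apply: integrableS (continuous_integrable_itv f b c cf) => //.
by move=> x /=; rewrite !in_itv/= => /andP[/ltW -> ->].
Qed.

Lemma Rintegral_cst_itv (a b c : R) : a <= b ->
  \int[leb]_(x in `[a, b]) c = c * (b - a).
Proof.
move=> ab; rewrite Rintegral_cst//= lebesgue_measure_itv/= lte_fin.
by move: ab; rewrite le_eqVlt => /predU1P[->|->]//=; rewrite ltxx subrr.
Qed.

Lemma Rintegral_affine (G : R -> R) (s u : R) : continuous G -> s < u ->
  \int[leb]_(x in `[s, u]) G x =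
  (u - s) * \int[leb]_(x in `[0, 1]) G (s + (u - s) * x).
Proof.
move=> cG; rewrite -subr_gt0; set a := u - s => a0.
pose F x : R := s + a * x.
have dF (x : R) : is_derive x 1 F a.
  have : is_derive x 1 (cst s + a *: (id : R -> R)) (0 + a *: 1).
    by apply: is_deriveD.
  by rewrite add0r /GRing.scale/= mulr1.
have F'E : derive1 F = cst a.
  by apply/funext => x; rewrite derive1E; exact: derive_val.
have cF : continuous F.
  move=> x; apply: differentiable_continuous; apply/derivable1_diffP.
  exact: ex_derive.
have := @integration_by_substitution_increasing R F G 0 1 ler01.
have F0 : F 0 = s by rewrite /F mulr0 addr0.
have F1 : F 1 = u by rewrite /F mulr1 /a addrC subrK.
rewrite F'E F0 F1 /Rintegral => ->.
- rewrite -[a in RHS]/(fine a%:E) -fineM//; last first.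
    apply: integrable_fin_num => //; apply: continuous_integrable_itv => x.
    apply: continuous_comp; [exact: cF|exact: cG].
  rewrite -integralZl//; last first.
    apply: continuous_integrable_itv => x.
    apply: (@continuous_comp _ _ _ F G); [exact: cF|exact: cG].
  by congr fine; apply: eq_integral => x _ /=; rewrite /F -EFinM mulrC.
- by move=> x y _ _ xy; rewrite /F ltrD2l ltr_pM2l.
- by move=> x _; exact: cst_continuous.
- exact: is_cvg_cst.
- exact: is_cvg_cst.
- split => //.
  + by apply: cvg_at_right_filter; exact: cF.
  + by apply: cvg_at_left_filter; exact: cF.
- exact: continuous_subspaceT.
Qed.

End affine_integral.

(** * Cost of a segment *)

Section segment_cost.
Context {R : realType} {d : nat}.
Implicit Types a b c x y : 'rV[R]_d.
Local Notation leb := (@lebesgue_measure R).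

Definition seg a b (s : R) : 'rV[R]_d := a + s *: (b - a).

Lemma seg0 a b : seg a b 0 = a.
Proof. by rewrite /seg scale0r addr0. Qed.

Lemma seg1 a b : seg a b 1 = b.
Proof. by rewrite /seg scale1r addrC subrK. Qed.

Lemma seg_sub a b s t : seg a b s - seg a b t = (s - t) *: (b - a).
Proof. by rewrite /seg opprD addrACA subrr add0r scalerBl. Qed.

Lemma seg_diff a b a' b' s :
  seg a' b' s - seg a b s = (1 - s) *: (a' - a) + s *: (b' - b).
Proof.
by apply/rowP => i; rewrite /seg !mxE; ring.
Qed.

Lemma enorm_seg_sub a b s t :
  enorm (seg a b s - seg a b t) = `|s - t| * enorm (b - a).
Proof. by rewrite seg_sub enormZ. Qed.

(** What the proof uses of the distance to measure g and of the convex set K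
    of diameter Delta. The number N depends on the mass parameter only. *)
Record tame_weight (beta Delta : R) (N : nat) (K : set 'rV[R]_d)
    (g : 'rV[R]_d -> R) : Prop := TameWeight {
  tw_beta : 1 <= beta;
  tw_Delta : 0 < Delta;
  tw_ge0 : forall x, 0 <= g x;
  tw_lip : forall x y, g x <= g y + enorm (x - y);
  tw_le : forall x, K x -> g x <= Delta;
  tw_seg : forall x y s, K x -> K y -> 0 <= s <= 1 -> K (seg x y s);
  tw_diam : forall x y, K x -> K y -> enorm (x - y) <= Delta;
  tw_N : (0 < N)%N;
  tw_packing : forall (r : R) (z : 'I_N -> 'rV[R]_d), 0 < r ->
    (forall i j, i != j -> 4 * r <= enorm (z i - z j)) -> exists i, r <= g (z i)
}.

Definition segmean : R -> ('rV[R]_d -> R) -> 'rV[R]_d -> 'rV[R]_d -> R :=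
  locked (fun beta g a b => \int[leb]_(s in `[0, 1]) (g (seg a b s) `^ beta)).

Definition segcost (beta : R) (g : 'rV[R]_d -> R) a b : R :=
  enorm (b - a) * segmean beta g a b.

Context {beta Delta : R} {N : nat} {K : set 'rV[R]_d} {g : 'rV[R]_d -> R}.
Hypothesis W : tame_weight beta Delta N K g.

Local Notation smean := (segmean beta g).
Local Notation scost := (segcost beta g).

Lemma segmeanE a b :
  smean a b = \int[leb]_(s in `[0, 1]) (g (seg a b s) `^ beta).
Proof. by rewrite /segmean -lock. Qed.

Lemma beta_ge0 : 0 <= beta.
Proof. by rewrite (le_trans ler01)// (tw_beta _ _ _ _ _ W). Qed.

Lemma tame_weight_continuous : continuous (fun x => g x `^ beta).
Proof.
move=> x; have g0 := tw_ge0 _ _ _ _ _ W; have b1 := tw_beta _ _ _ _ _ W.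
have gc : continuous g := enorm_lip_continuous _ (tw_lip _ _ _ _ _ W).
apply/(@cvgrPdist_lt _ _ _ (nbhs x)) => e e0.
pose c := beta * (g x + 1) `^ (beta - 1) + 1.
have c0 : 0 < c by rewrite ltr_wpDl// mulr_ge0 ?beta_ge0 ?powR_ge0.
near=> y.
have xy : `|g x - g y| < Num.min 1 (e / c).
  near: y; apply: (@cvgr_dist_lt _ _ _ (nbhs x) _ g); first exact: gc.
  by rewrite lt_min ltr01 divr_gt0.
move: xy; rewrite lt_min => /andP[xy1 xye].
set D := `|g x - g y| in xy1 xye *.
have D0 : 0 <= D by exact: normr_ge0.
have DD : - D <= g x - g y <= D by rewrite -ler_norml.
have h1 : g y `^ beta <= g x `^ beta + (c - 1) * D.
  by rewrite addrK powR_le_add//; lra.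
have h2 : g x `^ beta <= g y `^ beta + (c - 1) * D.
  by rewrite addrK powR_le_add//; lra.
have : c * D < e by rewrite mulrC -ltr_pdivlMr.
by rewrite mulrBl mul1r in h1 h2; rewrite ltr_norml; lra.
Unshelve. all: by end_near. Qed.

Lemma seg_continuous a b : continuous (seg a b).
Proof.
move=> s; apply: (@cvgD _ _ _ (nbhs s) _ (cst a) (fun s => s *: (b - a))).
  exact: cvg_cst.
exact: scalel_continuous.
Qed.

Lemma tame_seg_continuous a b : continuous (fun s => g (seg a b s) `^ beta).
Proof.
move=> s; apply: (@continuous_comp _ _ _ (seg a b) (fun x => g x `^ beta)).
  exact: seg_continuous.
exact: tame_weight_continuous.
Qed.

Lemma segmean_le a b w :
  (forall s, 0 <= s <= 1 -> g (seg a b s) `^ beta <= w) -> smean a b <= w.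
Proof.
move=> h; have <- : \int[leb]_(s in `[0, 1]) w = w.
  by rewrite Rintegral_cst_itv// subr0 mulr1.
rewrite segmeanE; apply: le_Rintegral => //=.
- exact: continuous_integrable_itv (tame_seg_continuous a b).
- by apply: continuous_integrable_itv; exact: cst_continuous.
Qed.

Lemma segmean_ge a b s t w : 0 <= s -> s <= t -> t <= 1 ->
  (forall u, s <= u <= t -> w <= g (seg a b u) `^ beta) ->
  w * (t - s) <= smean a b.
Proof.
move=> s0 st t1 h.
have c := tame_seg_continuous a b.
have i0 u v : 0 <= \int[leb]_(s in `[u, v]) (g (seg a b s) `^ beta).
  by apply: Rintegral_ge0 => x _; exact: powR_ge0.
rewrite segmeanE (Rintegral_itv_split _ _ s)//; last exact: le_trans t1.
rewrite (Rintegral_itv_split _ s t 1)//.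
have : w * (t - s) <= \int[leb]_(s in `[s, t]) (g (seg a b s) `^ beta).
  rewrite -Rintegral_cst_itv//; apply: le_Rintegral => //=.
  - by apply: continuous_integrable_itv; exact: cst_continuous.
  - exact: continuous_integrable_itv.
by move=> h3; rewrite (le_trans h3)// addrCA lerDl addr_ge0.
Qed.

Lemma segmean_ge0 a b : 0 <= smean a b.
Proof. by rewrite segmeanE; apply: Rintegral_ge0 => s _; exact: powR_ge0. Qed.

Lemma segcost_ge0 a b : 0 <= scost a b.
Proof. by rewrite mulr_ge0 ?enorm_ge0 ?segmean_ge0. Qed.

Lemma segmean_le_Delta a b : K a -> K b -> smean a b <= Delta `^ beta.
Proof.
move=> Ka Kb; apply: segmean_le => s s01.
rewrite ge0_ler_powR ?nnegrE ?beta_ge0 ?(tw_ge0 _ _ _ _ _ W) ?(ltW (tw_Delta _ _ _ _ _ W))//.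
exact: (tw_le _ _ _ _ _ W _ (tw_seg _ _ _ _ _ W _ _ _ Ka Kb s01)).
Qed.

(** The point where g is smallest on the segment. *)
Lemma segmean_point a b :
  exists2 s, 0 <= s <= 1 & g (seg a b s) `^ beta <= smean a b.
Proof.
have [s s01 smin] := EVT_min ler01
  (continuous_subspaceT (tame_seg_continuous a b)).
exists s => //; rewrite -[leLHS]mulr1 -[X in _ * X](subr0 (1 : R)).
by apply: segmean_ge => // u u01; exact: smin.
Qed.

Lemma segcost_split a c t : 0 <= t <= 1 ->
  scost a c = scost a (seg a c t) + scost (seg a c t) c.
Proof.
move=> /andP[t0 t1].
have cont := tame_seg_continuous a c.
have E1 : seg a c t - a = t *: (c - a) by rewrite -[X in _ - X](seg0 a c) seg_sub subr0.
have E2 : c - seg a c t = (1 - t) *: (c - a).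
  by rewrite -[X in X - _](seg1 a c) seg_sub.
rewrite /segcost E1 E2 !enormZ !ger0_norm ?subr_ge0//.
have S1 s : seg a (seg a c t) s = seg a c (0 + t * s).
  by rewrite {1}/seg E1 scalerA add0r mulrC.
have S2 s : seg (seg a c t) c s = seg a c (t + (1 - t) * s).
  rewrite {1}/seg E2 scalerA /seg -addrA -scalerDl; congr (_ + _ *: _); ring.
suff E : smean a c = t * smean a (seg a c t) + (1 - t) * smean (seg a c t) c.
  by rewrite E; move: (smean _ _) (smean _ _) => A B; ring.
rewrite [LHS]segmeanE (Rintegral_itv_split _ _ t)//; congr (_ + _).
- have [->|tn0] := eqVneq t 0.
    by rewrite mul0r set_itv1 Rintegral_set1.
  have tgt0 : 0 < t by rewrite lt_neqAle eq_sym tn0.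
  apply: (etrans (Rintegral_affine _ 0 t cont tgt0)); congr (_ * _).
    by rewrite subr0.
  by rewrite segmeanE; apply: eq_Rintegral => s _; rewrite S1 subr0.
- have [->|tn1] := eqVneq t 1.
    by rewrite subrr mul0r set_itv1 Rintegral_set1.
  have tlt1 : t < 1 by rewrite lt_neqAle tn1.
  apply: (etrans (Rintegral_affine _ t 1 cont tlt1)); congr (_ * _).
  by rewrite segmeanE; apply: eq_Rintegral => s _; rewrite S2.
Qed.

(** Moving both endpoints by e changes the length by at most 2e and the
    density by at most e. *)
Lemma segcost_move a b a' b' e : K a' -> K b' -> K a -> K b ->
  enorm (a' - a) <= e -> enorm (b' - b) <= e ->
  scost a' b' <= scost a b + (beta + 2) * Delta `^ beta * e.
Proof.
move=> Ka' Kb' Ka Kb ae be.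
have D0 := ltW (tw_Delta _ _ _ _ _ W).
have b1 := tw_beta _ _ _ _ _ W.
have g0 := tw_ge0 _ _ _ _ _ W.
have e0 : 0 <= e := le_trans (enorm_ge0 _) ae.
have dist s : 0 <= s <= 1 -> enorm (seg a' b' s - seg a b s) <= e.
  move=> /andP[s0 s1]; rewrite seg_diff (le_trans (ler_enormD _ _))// !enormZ.
  rewrite !ger0_norm ?subr_ge0//.
  have := ler_wpM2l s0 be; have : (1 - s) * enorm (a' - a) <= (1 - s) * e.
    by rewrite ler_wpM2l// subr_ge0.
  lra.
set k := beta * Delta `^ (beta - 1) * e.
have k0 : 0 <= k by rewrite !mulr_ge0 ?beta_ge0 ?powR_ge0.
have mm : smean a' b' <= smean a b + k.
  have <- : \int[leb]_(s in `[0, 1]) k = k.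
    by rewrite Rintegral_cst_itv// subr0 mulr1.
  rewrite !segmeanE -RintegralD//; last 2 first.
  - exact: continuous_integrable_itv (tame_seg_continuous a b).
  - by apply: continuous_integrable_itv; exact: cst_continuous.
  apply: le_Rintegral => //.
  - exact: continuous_integrable_itv (tame_seg_continuous a' b').
  - apply: (continuous_integrable_itv (fun s => g (seg a b s) `^ beta + k)) => s.
    apply: (@cvgD _ _ _ (nbhs s) _ (fun s => g (seg a b s) `^ beta) (cst k)).
      exact: tame_seg_continuous.
    exact: cvg_cst.
  move=> s /=; rewrite in_itv/= => s01.
  apply: powR_le_add => //.
    by rewrite (le_trans (tw_lip _ _ _ _ _ W _ (seg a b s)))// lerD2l dist.
  exact: (tw_le _ _ _ _ _ W _ (tw_seg _ _ _ _ _ W _ _ _ Ka' Kb' s01)).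
have len : enorm (b' - a') <= enorm (b - a) + 2 * e.
  have -> : b' - a' = (b' - b) + (b - a) - (a' - a).
    by apply/rowP => i; rewrite !mxE; ring.
  rewrite (le_trans (ler_enormD _ _))// enormN.
  apply: (le_trans (lerD (le_trans (ler_enormD _ _) (lerD be (lexx _))) ae)).
  by move: (enorm _) => l; clear ae be dist mm; lra.
have mD := segmean_le_Delta a' b' Ka' Kb'.
have m0 := segmean_ge0 a' b'.
have lD : enorm (b - a) <= Delta := tw_diam _ _ _ _ _ W _ _ Kb Ka.
have Db : Delta * Delta `^ (beta - 1) = Delta `^ beta.
  have nz : (1 + (beta - 1) == 0) ==> (Delta != 0).
    by apply/implyP => _; rewrite gt_eqF// (tw_Delta _ _ _ _ _ W).
  by have := powRD nz; rewrite powRr1// => <-; rewrite addrC subrK.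
rewrite /segcost -Db -mulrA; set P := Delta `^ (beta - 1).
rewrite (le_trans (ler_wpM2r m0 len))// mulrDl.
have h1 : enorm (b - a) * smean a' b' <= enorm (b - a) * smean a b + Delta * k.
  rewrite (le_trans (ler_wpM2l (enorm_ge0 _) mm))// mulrDr lerD2l.
  by rewrite ler_wpM2r.
have h2 : 2 * e * smean a' b' <= 2 * e * (Delta * P).
  by rewrite ler_wpM2l ?mulr_ge0// /P Db.
move: h1 h2; rewrite /k -/P.
have -> : (beta + 2) * (Delta * P * e) = Delta * (beta * P * e) + 2 * e * (Delta * P).
  by ring.
by move=> h1 h2; rewrite addrA; apply: lerD.
Qed.

(** Among N evenly spaced points of the segment one has density at least
    l / (4N), hence so has, up to a factor 2, a stretch of length l / (8N)
    after it. *)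
Lemma segmean_lower a b :
  (enorm (b - a) / (8 * N%:R)) `^ beta / (8 * N%:R) <= smean a b.
Proof.
have N0 : 0 < N%:R :> R by rewrite ltr0n (tw_N _ _ _ _ _ W).
have b1 := tw_beta _ _ _ _ _ W.
have [l0|l0] := eqVneq (enorm (b - a)) 0.
  rewrite l0 mul0r powR0 ?mul0r ?segmean_ge0//; apply: lt0r_neq0; lra.
have lgt0 : 0 < enorm (b - a) by rewrite lt_neqAle eq_sym l0 enorm_ge0.
set l := enorm (b - a) in lgt0 *.
pose z (i : 'I_N) := seg a b (i%:R / N%:R).
have r0 : 0 < l / (4 * N%:R) by rewrite divr_gt0// mulr_gt0.
have [i gi] : exists i, l / (4 * N%:R) <= g (z i).
  apply: (tw_packing _ _ _ _ _ W) => // i j ij.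
  rewrite /z enorm_seg_sub -/l -mulrBl normrM normfV (gtr0_norm N0).
  have -> : 4 * (l / (4 * N%:R)) = 1 / N%:R * l.
    by field; rewrite gt_eqF.
  rewrite ler_wpM2r ?(ltW lgt0)// ler_wpM2r ?invr_ge0 ?(ltW N0)//.
  have : (i.+1 <= j)%N \/ (j.+1 <= i)%N.
    by move: ij; rewrite -val_eqE neq_ltn => /orP[]; [left|right].
  by case; rewrite -(ler_nat R) -natr1 => h; rewrite ler_normr; apply/orP;
    [right|left]; lra.
pose h : R := (8 * N%:R)^-1.
have h0 : 0 < h by rewrite invr_gt0 mulr_gt0.
have iN : i%:R / N%:R + h <= 1.
  have : (i : nat).+1%:R <= N%:R :> R by rewrite ler_nat.
  rewrite -natr1 => iN; have E : i%:R / N%:R + h = (i%:R + 8^-1) / N%:R.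
    by rewrite /h; field; rewrite gt_eqF.
  by rewrite E ler_pdivrMr//; lra.
have i0 : 0 <= i%:R / N%:R :> R by rewrite divr_ge0// ltW.
have -> : (l / (8 * N%:R)) `^ beta / (8 * N%:R) =
    (l * h) `^ beta * ((i%:R / N%:R + h) - i%:R / N%:R) by rewrite /h addrAC subrr add0r.
apply: segmean_ge => //; first by rewrite lerDl ltW.
move=> u /andP[iu ui]; rewrite ge0_ler_powR ?nnegrE ?beta_ge0 ?(tw_ge0 _ _ _ _ _ W)//.
  by rewrite mulr_ge0 ?ltW.
have := tw_lip _ _ _ _ _ W (z i) (seg a b u).
rewrite /z enorm_seg_sub -/l => lip.
have : `|i%:R / N%:R - u| * l <= h * l.
  by rewrite ler_wpM2r ?(ltW lgt0)// ler_norml; lra.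
have : l / (4 * N%:R) = 2 * (h * l) by rewrite /h; field; rewrite gt_eqF.
by move: gi lip; rewrite /z; lra.
Qed.

End segment_cost.

(** * Length of polygons without cheap shortcuts *)

Section length_bound.
Context {R : realType} {d : nat}.
Context {beta Delta : R} {N : nat} {K : set 'rV[R]_d} {g : 'rV[R]_d -> R}.
Hypothesis W : tame_weight beta Delta N K g.
Local Notation smean := (segmean beta g).
Local Notation scost := (segcost beta g).
Implicit Types x y : 'rV[R]_d.

(** The root makes it comparable with lengths and with the values of g. *)
Definition segdens x y : R := smean x y `^ beta^-1.

(** A segment of density a has length at most kappa a, and g < tau a at its
    start if a > 0. The last two constants bound, in units of r, the length of
    the segments of density about r that start in one ball of radius 4 tau r,
    and the length of all segments of density at most r. *)
Definition kappa : R := (8 * N%:R) ^+ 2.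
Definition tau : R := kappa + 2.
Definition ball_const : R := 8 * tau * (32 * tau) `^ beta + kappa.
Definition len_const : R := 2 * (N%:R * ball_const).

Lemma beta_gt0 : 0 < beta.
Proof. exact: lt_le_trans ltr01 (tw_beta _ _ _ _ _ W). Qed.

Lemma kappa_ge0 : 0 <= kappa. Proof. exact: sqr_ge0. Qed.

Lemma tau_gt0 : 0 < tau.
Proof. by rewrite ltr_wpDl ?kappa_ge0. Qed.

Lemma ball_const_ge0 : 0 <= ball_const.
Proof.
by rewrite addr_ge0 ?kappa_ge0// !mulr_ge0 ?powR_ge0// ltW ?tau_gt0.
Qed.

Lemma segdens_ge0 x y : 0 <= segdens x y.
Proof. exact: powR_ge0. Qed.

Lemma segdensK x y : segdens x y `^ beta = smean x y.
Proof.
rewrite /segdens -powRrM mulVf ?gt_eqF ?beta_gt0// powRr1//.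
exact: (segmean_ge0).
Qed.

Lemma ler_powR_beta (s t : R) : 0 <= s -> 0 <= t ->
  (s `^ beta <= t `^ beta) = (s <= t).
Proof.
move=> s0 t0; apply/idP/idP => [|st]; last by rewrite ge0_ler_powR ?nnegrE ?(ltW beta_gt0).
by apply: contraTT; rewrite -!ltNge => ts; rewrite gt0_ltr_powR ?nnegrE ?beta_gt0.
Qed.

(** This is segmean_lower solved for the length; as beta >= 1, the factor
    (8 N) ^ (1 + 1 / beta) which results is at most kappa. *)
Lemma enorm_le_segdens x y : enorm (y - x) <= kappa * segdens x y.
Proof.
have N1 : 1 <= N%:R :> R by rewrite ler1n (tw_N _ _ _ _ _ W).
have b1 := tw_beta _ _ _ _ _ W.
have q1 : 1 <= 8 * N%:R :> R by clear b1; lra.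
have q0 : 0 < 8 * N%:R :> R := lt_le_trans ltr01 q1.
have := segmean_lower W x y; rewrite -segdensK ler_pdivrMr//.
move: (segdens_ge0 x y) (enorm_ge0 (y - x)).
rewrite /kappa; move: (segdens x y) (enorm _) (8 * N%:R) q0 q1 => a l q q0 q1 a0 l0 h.
have : (l / q) `^ beta <= (q * a) `^ beta.
  rewrite (le_trans h)// powRM ?(ltW q0)// mulrC ler_wpM2r ?powR_ge0//.
  by rewrite -[leLHS](@powRr1 _ q) ?(ltW q0)// ler_powR.
rewrite ler_powR_beta ?divr_ge0 ?mulr_ge0 ?(ltW q0)// ler_pdivrMr//.
by rewrite mulrAC -expr2.
Qed.

(** Somewhere on the segment g is at most its beta-mean, and the start is at
    distance at most kappa times the mean from there. *)
Lemma weight_le_segdens x y : g x <= (1 + kappa) * segdens x y.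
Proof.
have [s /andP[s0 s1]] := segmean_point W x y.
rewrite -segdensK ler_powR_beta ?segdens_ge0 ?(tw_ge0 _ _ _ _ _ W)// => gs.
rewrite (le_trans (tw_lip _ _ _ _ _ W x (seg x y s)))// mulrDl mul1r lerD//.
rewrite -[X in X - _](seg0 x y) enorm_seg_sub sub0r normrN ger0_norm//.
by rewrite (le_trans _ (enorm_le_segdens x y))// ler_piMl ?enorm_ge0.
Qed.

Lemma segdens_le_Delta x y : K x -> K y -> segdens x y <= Delta.
Proof.
move=> Kx Ky; rewrite -ler_powR_beta ?segdens_ge0 ?(ltW (tw_Delta _ _ _ _ _ W))//.
by rewrite segdensK (segmean_le_Delta W).
Qed.

Lemma segcost_le_near x y (r : R) : enorm (y - x) <= r -> g x <= r ->
  scost x y <= r * (2 * r) `^ beta.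
Proof.
move=> yx gx; rewrite /segcost ler_pM ?enorm_ge0 ?(segmean_ge0)//.
apply: (segmean_le W) => s /andP[s0 s1].
have r0 : 0 <= r := le_trans (enorm_ge0 _) yx.
rewrite ler_powR_beta ?(tw_ge0 _ _ _ _ _ W) ?mulr_ge0//.
rewrite (le_trans (tw_lip _ _ _ _ _ W _ x))//.
rewrite -[X in _ - X](seg0 x y) enorm_seg_sub subr0 ger0_norm//.
have : s * enorm (y - x) <= r.
  by rewrite (le_trans _ yx)// ler_piMl ?enorm_ge0.
by move: gx; clear; move: (g x) (s * _) => a b; lra.
Qed.

Definition shortcut_optimal (n : nat) (v : nat -> 'rV[R]_d) : Prop :=
  forall i j, (i <= j <= n)%N ->
  \sum_(i <= k < j) scost (v k) (v k.+1) <= scost (v i) (v j).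

Context (n : nat) (v : nat -> 'rV[R]_d).
Hypothesis v_opt : shortcut_optimal n v.
Hypothesis v_K : forall i, (i <= n)%N -> K (v i).

Let len k := enorm (v k.+1 - v k).
Let dens k := segdens (v k) (v k.+1).

(** The segments of density about r which start in a given ball of radius about
    r: all but the last belong to the part of the polygon that the segment from
    the first to the last start could replace, and this bounds their cost. *)
Lemma ball_length (r : R) (c : 'rV[R]_d) : 0 < r ->
  \sum_(k < n | (r / 2 < dens k <= r) && (enorm (v k - c) < 4 * (tau * r))) len k
  <= ball_const * r.
Proof.
move=> r0.
pose P (k : 'I_n) :=
  (r / 2 < dens k <= r) && (enorm (v k - c) < 4 * (tau * r)).
change (\sum_(k < n | P k) len k <= ball_const * r).
have t0 := tau_gt0.
have rho0 : 0 < tau * r by rewrite mulr_gt0.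
have [k0 Pk0|P0] := pickP P; last first.
  by rewrite big_pred0// mulr_ge0 ?ball_const_ge0 ?ltW.
case: (arg_minnP (fun k : 'I_n => k : nat) Pk0) => i Pi imin.
case: (arg_maxnP (fun k : 'I_n => k : nat) Pk0) => l Pl lmax.
rewrite (bigD1 l)//= /ball_const mulrDl addrC lerD//; last first.
  move: Pl => /andP[/andP[_ dl] _]; rewrite (le_trans (enorm_le_segdens _ _))//.
  by rewrite ler_wpM2l ?kappa_ge0.
have r2 : 0 < (r / 2) `^ beta by rewrite powR_gt0 ?divr_gt0.
rewrite -(ler_pM2r r2) mulr_suml.
apply: (@le_trans _ _ (\sum_(i <= k < l) scost (v k) (v k.+1))).
  rewrite (big_nat_widen i l n) ?(ltnW (ltn_ord l))// (big_nat_widenl _ 0)// big_mkord.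
  apply: (@le_trans _ _ (\sum_(k < n | P k && (k != l)) scost (v k) (v k.+1))).
    apply: ler_sum => k /andP[/andP[/andP[dk _] _] _].
    rewrite /segcost ler_wpM2l ?enorm_ge0// -segdensK.
    by rewrite ler_powR_beta ?segdens_ge0 ?divr_ge0 ?(ltW r0) ?(ltW dk).
  rewrite [leLHS]big_mkcond [leRHS]big_mkcond; apply: ler_sum => k _.
  case: ifP => [/andP[Pk kl]|_]; last first.
    by case: ifP => // _; exact: (segcost_ge0).
  have klt : (k < l)%N by rewrite ltn_neqAle kl; exact: lmax.
  by rewrite klt (imin k Pk).
have il : (i <= l)%N := imin _ Pl.
apply: le_trans (v_opt _ _ _) _; first by rewrite il/= ltnW.
have gi : g (v i) <= 8 * (tau * r).
  rewrite (le_trans (weight_le_segdens _ (v i.+1)))//.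
  move: Pi => /andP[/andP[_ di] _].
  rewrite (@le_trans _ _ ((1 + kappa) * r))// ?ler_wpM2l ?addr_ge0 ?kappa_ge0//.
  rewrite mulrA ler_wpM2r ?(ltW r0)// /tau; have := kappa_ge0; lra.
have vil : enorm (v l - v i) <= 8 * (tau * r).
  move: Pi Pl => /andP[_ ic] /andP[_ lc].
  rewrite (le_trans (enorm_triangle c _ _))// (enormC c) (le_trans (ltW (ltrD lc ic)))//.
  by clear ic lc; move: (tau * r) => x; lra.
apply: le_trans (segcost_le_near _ _ _ vil gi) _.
have -> : 2 * (8 * (tau * r)) = 32 * tau * (r / 2) by field.
rewrite powRM ?mulr_ge0 ?divr_ge0 ?(ltW t0) ?(ltW r0)//.
by rewrite le_eqVlt; apply/orP; left; apply/eqP; ring.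
Qed.

(** A maximal family of starts at mutual distance at least 4 tau r has less
    than N elements because g is less than tau r at each of them. *)
Lemma level_length (r : R) : 0 < r ->
  \sum_(k < n | r / 2 < dens k <= r) len k <= N%:R * ball_const * r.
Proof.
move=> r0; have t0 := tau_gt0.
have rho0 : 0 < tau * r by rewrite mulr_gt0.
pose I := [set k : 'I_n | r / 2 < dens k <= r]%SET.
pose near (k j : 'I_n) := enorm (v k - v j) < 4 * (tau * r).
pose sep (J : {set 'I_n}) := (J \subset I) &&
  [forall i in J, forall j in J, (i != j) ==> ~~ near i j].
have sep0 : sep finset.set0.
  by rewrite /sep finset.sub0set; apply/forallP => i; rewrite inE.
case: (arg_maxnP (fun J : {set 'I_n} => #|J|) sep0) => J /andP[JI Jsep] Jmax.
have Jnear k : k \in I -> exists2 j, j \in J & near k j.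
  move=> kI; apply: contrapT => nex.
  have nn j : j \in J -> ~~ near k j.
    by move=> jJ; apply/negP => kj; apply: nex; exists j.
  have kJ : k \notin J.
    apply/negP => kJ; have := nn _ kJ.
    by rewrite /near subrr enorm0 mulr_gt0.
  have : sep (k |: J)%SET.
    rewrite /sep finset.subUset finset.sub1set kI JI/=; apply/forall_inP => i.
    rewrite finset.in_setU1 => /predU1P[->|iJ]; apply/forall_inP => j;
      rewrite finset.in_setU1 => /predU1P[->|jJ]; apply/implyP => ij.
    - by rewrite eqxx in ij.
    - exact: nn.
    - by rewrite /near enormC; exact: nn.
    - by move/forall_inP : Jsep => /(_ _ iJ) /forall_inP /(_ _ jJ) /implyP; exact.
  by move=> /Jmax; rewrite /= cardsU1 kJ add1n /geq/= ltnn.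
have JN : (#|J| < N)%N.
  rewrite ltnNge; apply/negP => NJ.
  pose z (i : 'I_N) := enum_val (widen_ord NJ i).
  have [i j ij|i] := tw_packing _ _ _ _ _ W (tau * r) (fun i => v (z i)) rho0.
    have zij : z i != z j.
      by apply: contra_neq ij => /enum_val_inj /(congr1 val) /= /val_inj.
    have zJ k : z k \in J by exact: enum_valP.
    move/forall_inP : Jsep => /(_ (z i) (zJ i)) /forall_inP.
    by move=> /(_ (z j) (zJ j)) /implyP/(_ zij); rewrite /near -leNgt.
  apply/negP; rewrite -ltNge.
  have : z i \in I by apply: (fintype.subsetP JI); exact: enum_valP.
  rewrite inE => /andP[_ dr].
  apply: (le_lt_trans (weight_le_segdens _ (v (z i).+1))).
  rewrite (@le_lt_trans _ _ ((1 + kappa) * r))//.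
    by rewrite ler_wpM2l ?addr_ge0 ?kappa_ge0.
  by rewrite ltr_pM2r// /tau; lra.
apply: (@le_trans _ _ (\sum_(j in J) \sum_(k | (k \in I) && near k j) len k)).
  rewrite (exchange_big_dep (fun k => k \in I))/=; last by move=> i j _ /andP[].
  rewrite (eq_bigl (fun k => k \in I)); last by move=> k; rewrite inE.
  apply: ler_sum => k kI; have [j jJ kj] := Jnear k kI.
  rewrite (bigD1 j)/=; last by rewrite jJ kI.
  by rewrite lerDl sumr_ge0// => *; exact: enorm_ge0.
apply: (@le_trans _ _ (\sum_(j in J) ball_const * r)).
  apply: ler_sum => j _; apply: le_trans (ball_length _ (v j) r0).
  by rewrite le_eqVlt; apply/orP; left; apply/eqP/eq_bigl => k; rewrite inE.
rewrite sumr_const -[leLHS]mulr_natl -[leRHS]mulrA; apply: ler_wpM2r;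
  first by rewrite mulr_ge0 ?ball_const_ge0 ?(ltW r0).
by rewrite ler_nat ltnW.
Qed.

(** Summation of level_length over r, r / 2, ..., r / 2 ^ (j - 1). The segments
    of smaller density are bounded one by one, which is harmless because j will
    tend to infinity while n is fixed. *)
Lemma dyadic_length (r : R) (j : nat) : 0 < r ->
  \sum_(k < n | dens k <= r) len k <= len_const * r + n%:R * kappa * r / 2 ^+ j.
Proof.
have lc0 : 0 <= N%:R * ball_const by rewrite mulr_ge0 ?ball_const_ge0.
have k0 := kappa_ge0.
elim: j r => [|j IH] r r0.
  rewrite expr0 divr1; apply: (@le_trans _ _ (\sum_(k < n | dens k <= r) kappa * r)).
    apply: ler_sum => k kr; apply: (le_trans (enorm_le_segdens _ _)).
    by rewrite ler_wpM2l.
  apply: (@le_trans _ _ (\sum_(k < n) kappa * r)).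
    rewrite [leLHS]big_mkcond; apply: ler_sum => k _.
    by case: ifP => // _; rewrite mulr_ge0// ltW.
  rewrite sumr_const card_ord -[leLHS]mulr_natl mulrA lerDr.
  by rewrite mulr_ge0 ?(ltW r0)// mulr_ge0.
rewrite (bigID (fun k : 'I_n => r / 2 < dens k))/=.
have h1 := level_length r r0; have h2 := IH (r / 2) (divr_gt0 r0 (ltr0Sn _ 1)).
set A := \sum_(_ < _ | _) _; set B := \sum_(_ < _ | _) _.
have {}h1 : A <= N%:R * ball_const * r.
  by rewrite /A (eq_bigl (fun k : 'I_n => r / 2 < dens k <= r))// => k; rewrite andbC.
have {h2}: B <= len_const * (r / 2) + n%:R * kappa * (r / 2) / 2 ^+ j.
  rewrite /B (eq_bigl (fun k : 'I_n => dens k <= r / 2))// => k.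
  rewrite -leNgt andbC; case: leP => //= kr; apply: (le_trans kr).
  by rewrite ler_pdivrMr// ler_pMr// ler1n.
rewrite exprS invfM /len_const; move: h1; move: A B => A B; clear IH lc0 k0.
move: (N%:R * _) (n%:R * _) (2 ^+ j)^-1 => a b c.
have -> : b * r * (2^-1 * c) = b * (r / 2) * c by field.
by lra.
Qed.

Theorem optimal_length : \sum_(k < n) len k <= len_const * Delta.
Proof.
have D0 := tw_Delta _ _ _ _ _ W.
apply/ler_addgt0Pr => e e0.
pose c := n%:R * kappa * Delta.
have c0 : 0 <= c by rewrite !mulr_ge0 ?kappa_ge0 ?(ltW D0).
have [j cj] : exists j : nat, c / 2 ^+ j <= e.
  exists (Num.bound (c / e)).
  rewrite ler_pdivrMr ?exprn_gt0// mulrC -ler_pdivrMr//.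
  apply: ltW; apply: lt_trans (archi_boundP _) _; first by rewrite divr_ge0 ?(ltW e0).
  by rewrite -natrX ltr_nat ltn_expl.
rewrite (le_trans _ (lerD (lexx _) cj))//.
apply: le_trans (dyadic_length Delta j D0).
rewrite le_eqVlt; apply/orP; left; apply/eqP/eq_bigl => k.
by apply/esym/segdens_le_Delta; apply: v_K => //; exact: ltnW.
Qed.

End length_bound.

(** * Chains of segments *)

Section chains.
Context {R : realType} {d : nat}.
Context {beta Delta : R} {N : nat} {K : set 'rV[R]_d} {g : 'rV[R]_d -> R}.
Hypothesis W : tame_weight beta Delta N K g.
Local Notation scost := (segcost beta g).
Implicit Types (x y z : 'rV[R]_d) (F G : set 'rV[R]_d).

(** The inductive counterpart of a polygonal path. Only the vertices other than
    the two ends are in F, since a straight path may start and end outside. *)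
Inductive chain F : 'rV[R]_d -> 'rV[R]_d -> nat -> R -> R -> Prop :=
| Chain1 x y : chain F x y 1 (scost x y) (enorm (y - x))
| ChainCons x z y n C L : F z -> chain F z y n C L ->
    chain F x y n.+1 (scost x z + C) (enorm (z - x) + L).

Lemma chain_cat F x z y n n' C C' L L' : chain F x z n C L -> F z ->
  chain F z y n' C' L' -> chain F x y (n + n') (C + C') (L + L').
Proof.
move=> c; elim: c y n' C' L' => {x z n C L}
  [x z|x t z n C L Ft _ IH] y n' C' L' Fz c.
  exact: ChainCons.
by rewrite addSn -!addrA; apply: ChainCons => //; exact: IH.
Qed.

Lemma chain_vertices F x y n C L : chain F x y n C L -> exists v : nat -> 'rV[R]_d,
  [/\ (0 < n)%N, v 0%N = x, v n = y,
      (forall i, (0 < i < n)%N -> F (v i)) &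
      C = \sum_(k < n) scost (v k) (v k.+1) /\
      L = \sum_(k < n) enorm (v k.+1 - v k)].
Proof.
elim=> {x y n C L} [x y|x z y n C L Fz _ [v [n0 v0 vn vF [CE LE]]]].
  exists (fun k => if k is 0%N then x else y); split => //; first by case.
  by rewrite !big_ord1.
exists (fun k => if k is k'.+1 then v k' else x); split => //.
  by case=> // -[|i] ?; rewrite ?v0//; apply: vF.
by rewrite !big_ord_recl/= v0 CE LE; split.
Qed.

Lemma chain_of_vertices F n (v : nat -> 'rV[R]_d) :
  (forall i, (0 < i <= n)%N -> F (v i)) ->
  chain F (v 0%N) (v n.+1) n.+1 (\sum_(k < n.+1) scost (v k) (v k.+1))
    (\sum_(k < n.+1) enorm (v k.+1 - v k)).
Proof.
elim: n v => [|n IH] v vF; first by rewrite !big_ord1; exact: Chain1.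
rewrite !(big_ord_recl n.+1)/=; apply: ChainCons; first exact: vF.
by apply: (IH (fun k => v k.+1)) => i /andP[_ ilen]; exact: vF.
Qed.

(** A shortcut reduces the number of vertices, so that taking cheaper ones must
    come to an end. *)
Lemma optimal_polygon F n (v : nat -> 'rV[R]_d) : (0 < n)%N ->
  (forall i, (0 < i < n)%N -> F (v i)) ->
  exists n' v', [/\ (0 < n')%N, v' 0%N = v 0%N, v' n' = v n,
    (forall i, (0 < i < n')%N -> F (v' i)) &
    \sum_(k < n') scost (v' k) (v' k.+1) <= \sum_(k < n) scost (v k) (v k.+1) /\
    shortcut_optimal (beta := beta) (g := g) n' v'].
Proof.
have [m] := ubnP n; elim: m n v => // m IH n v nm n0 vF.
have [opt|nopt] := pselect (shortcut_optimal (beta := beta) (g := g) n v).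
  by exists n, v.
have [i [j [ij jn ijS]]] : exists i j, [/\ (i <= j)%N, (j <= n)%N &
    scost (v i) (v j) < \sum_(i <= k < j) scost (v k) (v k.+1)].
  apply: contrapT => nex; apply: nopt => i j /andP[ij jn]; rewrite leNgt.
  by apply/negP => ijS; apply: nex; exists i, j.
have {ij} ij : (i.+1 < j)%N.
  rewrite ltn_neqAle; apply/andP; split.
    by apply: contraTneq ijS => <-; rewrite big_nat1 ltxx.
  rewrite ltn_neqAle ij andbT; apply: contraTneq ijS => <-.
  by rewrite big_geq// -leNgt segcost_ge0.
pose s := (j - i.+1)%N.
have s0 : (0 < s)%N by rewrite subn_gt0.
have jE : j = (i.+1 + s)%N by rewrite subnKC// ltnW.
have isn : (i.+1 + s <= n)%N by rewrite -jE.
pose v1 k := if (k <= i)%N then v k else v (k + s)%N.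
have n1 : (i < n - s)%N by rewrite ltn_subRL addnC.
have [] := IH (n - s)%N v1.
- by rewrite (leq_trans _ (_ : n <= m)%N)// ltn_subrL s0.
- exact: leq_ltn_trans n1.
- move=> k /andP[k0 kn]; rewrite /v1; case: leqP => ki; apply: vF.
    by rewrite k0 (leq_ltn_trans ki)// (leq_trans n1)// leq_subr.
  by rewrite addn_gt0 k0/= addnC -ltn_subRL.
move=> n' [v' [n'0 v'0 v'n v'F [v'le v'opt]]]; exists n', v'; split => //.
- rewrite v'n /v1 leqNgt n1/= subnK//.
  by rewrite (leq_trans _ isn)// leq_addl.
split => //; apply: (le_trans v'le).
rewrite -!(big_mkord xpredT (fun k => scost (_ k) (_ k.+1))).
rewrite (@big_cat_nat _ _ _ i 0 (n - s))//=; last exact: ltnW.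
rewrite [leRHS](@big_cat_nat _ _ _ i 0 n)//=; last first.
  by rewrite (leq_trans _ isn)// addSn ltnW// ltnS leq_addr.
rewrite (big_ltn n1) [X in _ <= _ + X](@big_cat_nat _ _ _ j i n)//=; last first.
  by rewrite jE addSn ltnW// ltnS leq_addr.
rewrite lerD//.
  rewrite le_eqVlt; apply/orP; left; apply/eqP/eq_big_nat => k /andP[_ ki].
  by rewrite /v1 (ltnW ki) ki.
rewrite lerD//.
  by rewrite {1}/v1 leqnn /v1 ltnn -jE ltW.
rewrite jE [leRHS]big_addn le_eqVlt; apply/orP; left.
apply/eqP/eq_big_nat => k /andP[ik _]; rewrite /v1 leqNgt ik/=.
by rewrite leqNgt ltnW.
Qed.

(** Fusing consecutive segments of total length at most h. On such a group the
    density varies by at most 2h, so that its chord costs at most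
    2 beta Delta^(beta - 1) h per unit of length more. The hypotheses describe
    the group in progress, from b to x, of length l and cost c; it is empty at
    the start of the chain, where x may be outside F. A group is closed when the
    next segment would make it longer than h, hence there are at most
    two new segments for each h of old length. *)
Lemma coarsen_group F (h : R) x y n C L : 0 <= h -> chain F x y n C L ->
  F `<=` K -> K x -> K y ->
  forall b l c, K b -> F x \/ [/\ l = 0, c = 0 & b = x] ->
  enorm (x - b) <= l -> l <= h ->
  l * (Num.max 0 (g b - h)) `^ beta <= c ->
  exists n' C' L', [/\ chain F b y n' C' L',
    C' <= c + C + 2 * beta * Delta `^ (beta - 1) * h * (l + L) &
    n'%:R * h <= 2 * (l + L) + h].
Proof.
move=> h0 ch FK; pose e := 2 * beta * Delta `^ (beta - 1) * h.
have b0 := beta_ge0 W.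
have e0 : 0 <= e by rewrite !mulr_ge0 ?powR_ge0.
have g0 := tw_ge0 _ _ _ _ _ W.
have max0 b : 0 <= Num.max 0 (g b - h) by rewrite le_max lexx.
(* a chord of length at most l <= h against the lower bound on the group *)
have chord b q l c : K b -> K q -> enorm (q - b) <= l -> l <= h ->
    l * (Num.max 0 (g b - h)) `^ beta <= c -> scost b q <= c + e * l.
  move=> Kb Kq xl lh lc.
  have l0 : 0 <= l := le_trans (enorm_ge0 _) xl.
  have : segmean beta g b q <= Num.max 0 (g b - h) `^ beta + e.
    apply: (segmean_le W) => s s01.
    have -> : e = beta * Delta `^ (beta - 1) * (2 * h) by rewrite /e; ring.
    apply: powR_le_add; rewrite ?(tw_beta _ _ _ _ _ W) ?max0 ?g0 ?mulr_ge0//.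
      rewrite (le_trans (tw_lip _ _ _ _ _ W _ b))//.
      rewrite -[X in _ - X](seg0 b q) enorm_seg_sub subr0.
      case/andP: s01 => s0 s1; rewrite ger0_norm//.
      have : s * enorm (q - b) <= h.
        by rewrite (le_trans _ lh)// (le_trans _ xl)// ler_piMl ?enorm_ge0.
      have : g b - h <= Num.max 0 (g b - h) by rewrite le_max lexx orbT.
      clear xl lc.
      move: (g b) (Num.max _ _) (s * _) => u v w; lra.
    exact: (tw_le _ _ _ _ _ W _ (tw_seg _ _ _ _ _ W _ _ _ Kb Kq s01)).
  move=> me; rewrite /segcost.
  rewrite (le_trans (ler_pM (enorm_ge0 _) (segmean_ge0 _ _) xl me))//.
  by rewrite mulrDr (mulrC e) lerD2r.
(* adding one more segment to the group *)
have grow b q z l c : enorm (q - b) <= l -> l + enorm (z - q) <= h ->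
    l * (Num.max 0 (g b - h)) `^ beta <= c ->
    (l + enorm (z - q)) * (Num.max 0 (g b - h)) `^ beta <= c + scost q z.
  move=> xl lh lc; rewrite mulrDl lerD//.
  rewrite /segcost ler_wpM2l ?enorm_ge0//.
  rewrite -[leLHS]mulr1 -[X in _ * X](subr0 (1 : R)).
  apply: (segmean_ge W) => // s /andP[s0 s1].
  rewrite ge0_ler_powR ?nnegrE ?max0 ?g0// ge_max g0/=.
  have lip := tw_lip _ _ _ _ _ W b (seg q z s).
  have h1 : enorm (b - seg q z s) <= h.
    apply: le_trans lh; rewrite (le_trans (enorm_triangle q _ _))//.
    rewrite lerD//; first by rewrite enormC.
    rewrite -[X in X - _](seg0 q z) enorm_seg_sub sub0r normrN ger0_norm//.
    by rewrite ler_piMl ?enorm_ge0.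
  by rewrite lerBlDr (le_trans lip)// lerD2l.
elim: ch => {x y n C L} [x y|x z y n C L Fz ch IH] Kx Ky b l c Kb Fx xl lh lc.
  have ll := le_trans (enorm_ge0 _) xl.
  have [lyh|lyh] := leP (l + enorm (y - x)) h.
    exists 1%N, (scost b y), (enorm (y - b)); split; first exact: Chain1.
      apply: chord => //; last exact: grow.
      rewrite (le_trans (enorm_triangle x _ _))// addrC lerD2r//.
    by rewrite mul1r lerDr mulr_ge0// addr_ge0 ?enorm_ge0.
  case: Fx => [Fx|[l0 c0 bx]]; last first.
    exists 1%N, (scost b y), (enorm (y - b)); split; first exact: Chain1.
      by rewrite c0 add0r bx lerDl mulr_ge0// addr_ge0 ?enorm_ge0.
    by rewrite mul1r lerDr mulr_ge0// addr_ge0 ?enorm_ge0.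
  exists 2%N, (scost b x + scost x y), (enorm (x - b) + enorm (y - x)); split.
  - by apply: ChainCons => //; exact: Chain1.
  - have := chord _ _ _ _ Kb Kx xl lh lc; rewrite -/e mulrDr.
    have : 0 <= e * enorm (y - x) by rewrite mulr_ge0 ?enorm_ge0.
    clear xl lc lyh; move: (e * enorm _) (scost b x) (scost x y) (e * l).
    by move=> u1 u2 u3 u4; lra.
  - by move: lyh; move: (enorm _) => u; clear lc xl; lra.
have Kz : K z := FK _ Fz.
have ll := le_trans (enorm_ge0 _) xl.
have [lzh|lzh] := leP (l + enorm (z - x)) h.
  have [] := IH Kz Ky b (l + enorm (z - x)) (c + scost x z) Kb.
  - by left.
  - by rewrite (le_trans (enorm_triangle x _ _))// addrC lerD2r.
  - exact: lzh.
  - exact: grow.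
  move=> n' [C' [L' [ch' C'le n'le]]]; exists n', C', L'.
  by rewrite !addrA in C'le n'le *.
have [] := IH Kz Ky z 0 0 Kz.
- by left.
- by rewrite subrr enorm0.
- exact: h0.
- by rewrite mul0r.
move=> n' [C' [L' [ch']]]; rewrite !add0r -/e => C'le n'le.
have [Fx'|[l0 c0 bx]] := Fx; last first.
  exists n'.+1, (scost b z + C'), (enorm (z - b) + L'); split.
  - exact: ChainCons.
  - rewrite c0 l0 !add0r bx mulrDr -/e.
    have : 0 <= e * enorm (z - x) by rewrite mulr_ge0 ?enorm_ge0.
    clear xl lc lzh n'le; move: C'le.
    move: (e * enorm _) (scost x z) (e * L) => u1 u2 u3; lra.
  - rewrite -natr1 mulrDl mul1r l0; move: lzh; rewrite l0 !add0r => lzh.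
    by move: lzh n'le; clear xl lc C'le; move: (enorm _) (n'%:R * h) => u1 u2; lra.
exists n'.+2, (scost b x + (scost x z + C')), (enorm (x - b) + (enorm (z - x) + L')).
split.
- by do 2 apply: ChainCons => //.
- have := chord _ _ _ _ Kb Kx xl lh lc; rewrite -/e mulrDr.
  have : 0 <= e * enorm (z - x) by rewrite mulr_ge0 ?enorm_ge0.
  clear xl lc lzh n'le; rewrite mulrDr; move: C'le.
  move: (e * enorm _) (e * L) (scost x z) (scost b x) (e * l) => u1 u2 u3 u4 u5; lra.
- rewrite -2!natr1 !mulrDl !mul1r.
  by move: lzh n'le; clear xl lc C'le; move: (enorm _) (n'%:R * h) => u1 u2; lra.
Qed.

Lemma coarsen F (h : R) x y n C L : 0 <= h -> chain F x y n C L ->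
  F `<=` K -> K x -> K y ->
  exists n' C' L', [/\ chain F x y n' C' L',
    C' <= C + 2 * beta * Delta `^ (beta - 1) * h * L & n'%:R * h <= 2 * L + h].
Proof.
move=> h0 ch FK Kx Ky.
have [] := coarsen_group F h x y n C L h0 ch FK Kx Ky x 0 0 Kx.
- by right.
- by rewrite subrr enorm0.
- exact: h0.
- by rewrite mul0r.
move=> n' [C' [L' [ch' C'le n'le]]]; exists n', C', L'; split => //.
  by rewrite !add0r in C'le.
by rewrite add0r in n'le.
Qed.

(** Each segment pays the price of segcost_move once. *)
Lemma chain_move F G (e : R) x y n C L : chain F x y n C L ->
  F `<=` K -> G `<=` K -> (forall z, F z -> exists2 z', G z' & enorm (z' - z) <= e) ->
  0 <= e -> forall x', K x -> K x' -> K y -> enorm (x' - x) <= e ->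
  exists C' L', chain G x' y n C' L' /\
    C' <= C + n%:R * ((beta + 2) * Delta `^ beta * e).
Proof.
move=> ch FK GK FG e0; elim: ch => {x y n C L} [x y|x z y n C L Fz _ IH] x' Kx Kx' Ky xe.
  exists (scost x' y), (enorm (y - x')); split; first exact: Chain1.
  by rewrite mul1r; apply: (segcost_move W) => //; rewrite subrr enorm0.
have [z' Gz' ze] := FG _ Fz.
have [C' [L' [ch C'le]]] := IH z' (FK _ Fz) (GK _ Gz') Ky ze.
exists (scost x' z' + C'), (enorm (z' - x') + L'); split; first exact: ChainCons.
have := segcost_move W x z x' z' e Kx' (GK _ Gz') Kx (FK _ Fz) xe ze.
rewrite -[n.+1%:R]natr1 [(_ + 1) * _]mulrDl mul1r.
clear xe ze; move: C'le; move: (_ * e) (scost x' z') (scost x z) => t u v.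
by move: (n%:R * t) => w; lra.
Qed.

Definition transfer_const : R :=
  2 * beta * len_const (R := R) (beta := beta) (N := N) +
  (beta + 2) * (2 * len_const (R := R) (beta := beta) (N := N) + 2).

(** A chain in F is first made free of costly detours, which bounds its length,
    then coarsened at scale h = sqrt (Delta e) and moved to G. The coarsening
    costs O(h), and so does the displacement by e of the O(Delta / h) vertices. *)
Lemma chain_transfer F G (e : R) x y n C L : chain F x y n C L ->
  F `<=` K -> G `<=` K -> (forall z, F z -> exists2 z', G z' & enorm (z' - z) <= e) ->
  0 < e -> e <= 2 * Delta -> K x -> K y ->
  exists n' C' L', chain G x y n' C' L' /\
    C' <= C + transfer_const * (Delta `^ beta * Num.sqrt (Delta * e)).
Proof.
move=> ch FK GK FG e0 eD Kx Ky.
have D0 := tw_Delta _ _ _ _ _ W.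
have b0 := beta_ge0 W.
have [v [n0 v0 vn vF [CE _]]] := chain_vertices _ _ _ _ _ _ ch.
have [m1 [v1 [m10 v10 v1n v1F [C1 opt]]]] := optimal_polygon F n v n0 vF.
case: m1 m10 v1n v1F C1 opt => [//|n1] _ v1n v1F C1 opt.
have v1K i : (i <= n1.+1)%N -> K (v1 i).
  case: i => [|i] in1; first by rewrite v10 v0.
  move: in1; rewrite leq_eqVlt => /predU1P[->|in1]; first by rewrite v1n vn.
  by apply/FK/v1F.
have len := optimal_length W n1.+1 v1 opt v1K.
have := chain_of_vertices F n1 v1 v1F.
rewrite v10 v1n v0 vn.
rewrite -CE in C1; move: C1 len; move: (\sum_(_ < _) _) (\sum_(_ < _) _).
move=> L1 C1 C1C L1le ch1.
pose h := Num.sqrt (Delta * e).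
have h0 : 0 < h by rewrite sqrtr_gt0 mulr_gt0.
have hE : h * h = Delta * e by rewrite -expr2 sqr_sqrtr// mulr_ge0 ?ltW.
have [n2 [C2 [L2 [ch2 C2le n2le]]]] := coarsen F h x y _ _ _ (ltW h0) ch1 FK Kx Ky.
have [] := chain_move F G e x y n2 C2 L2 ch2 FK GK FG (ltW e0) x Kx Kx Ky.
  by rewrite subrr enorm0 ltW.
move=> C3 [L3 [ch3 C3le]]; exists n2, C3, L3; split => //.
rewrite (le_trans C3le)// -/h.
set lc := len_const in L1le; rewrite /transfer_const -/lc.
have Db : Delta * Delta `^ (beta - 1) = Delta `^ beta.
  have nz : (1 + (beta - 1) == 0) ==> (Delta != 0).
    by apply/implyP => _; rewrite gt_eqF.
  by have := powRD nz; rewrite powRr1 ?(ltW D0)// => <-; rewrite addrC subrK.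
have P0 : 0 <= Delta `^ beta := powR_ge0 _ _.
have Q0 : 0 <= Delta `^ (beta - 1) := powR_ge0 _ _.
have eh : e <= 2 * h.
  rewrite -(ler_pXn2r (n := 2))// ?nnegrE ?mulr_ge0 ?(ltW e0) ?(ltW h0)//.
  rewrite exprMn (expr2 h) hE expr2.
  have De : e * e <= 2 * (Delta * e) by rewrite mulrA ler_wpM2r ?(ltW e0).
  by rewrite (le_trans De)// ler_wpM2r ?mulr_ge0 ?(ltW e0) ?(ltW D0)//; lra.
have h1 : 2 * beta * Delta `^ (beta - 1) * h * L1 <=
    2 * beta * lc * (Delta `^ beta * h).
  rewrite -Db.
  have -> : 2 * beta * lc * (Delta * Delta `^ (beta - 1) * h) =
    2 * beta * Delta `^ (beta - 1) * h * (lc * Delta) by ring.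
  by rewrite ler_wpM2l// !mulr_ge0// ltW.
have h2 : n2%:R * e <= (2 * lc + 2) * h.
  rewrite -(ler_pM2l D0).
  have -> : Delta * (n2%:R * e) = n2%:R * h * h.
    by rewrite -mulrA hE; ring.
  apply: (@le_trans _ _ ((2 * (lc * Delta) + h) * h)).
    rewrite ler_wpM2r ?(ltW h0)// (le_trans n2le)// lerD2r ler_wpM2l//.
  have -> : Delta * ((2 * lc + 2) * h) = 2 * (lc * Delta) * h + Delta * (2 * h) by ring.
  by rewrite mulrDl hE lerD2l ler_wpM2l ?(ltW D0).
have h3 : n2%:R * ((beta + 2) * Delta `^ beta * e) <=
    (beta + 2) * (2 * lc + 2) * (Delta `^ beta * h).
  have -> : n2%:R * ((beta + 2) * Delta `^ beta * e) =
    (beta + 2) * Delta `^ beta * (n2%:R * e) by ring.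
  have -> : (beta + 2) * (2 * lc + 2) * (Delta `^ beta * h) =
    (beta + 2) * Delta `^ beta * ((2 * lc + 2) * h) by ring.
  by rewrite ler_wpM2l// mulr_ge0// addr_ge0.
rewrite (mulrDl (2 * beta * lc)) (addrA C); apply: lerD; last exact: h3.
exact: le_trans C2le (lerD C1C h1).
Qed.

End chains.

(** * Polygonal paths *)

Section piecewise_integral.
Context {R : realType}.
Local Notation leb := (@lebesgue_measure R).

Lemma integral_itv_cat (f : R -> \bar R) (a b c : R) : a <= b -> b <= c ->
  measurable_fun `[a, c]%classic f -> (forall x, a <= x <= c -> (0 <= f x)%E) ->
  (\int[leb]_(x in `[a, c]) f x =
   \int[leb]_(x in `[a, b]) f x + \int[leb]_(x in `[b, c]) f x)%E.
Proof.
move=> ab bc mf f0.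
have E : `[a, c]%classic = `[a, b[%classic `|` `[b, c]%classic.
  by rewrite -itv_bndbnd_setU// bnd_simp.
rewrite E ge0_integral_setU//; first last.
- apply/disj_setPS => y [/=]; rewrite !in_itv/= => /andP[_ yb] /andP[].
  by rewrite leNgt yb.
- by rewrite -E => y /=; rewrite in_itv/= => /f0.
- by rewrite -E.
congr (_ + _)%E; rewrite integral_itv_bndo_bndc//.
apply: measurable_funS mf => // y /=; rewrite !in_itv/= => /andP[-> yb] /=.
exact: le_trans (ltW yb) bc.
Qed.

(** The velocity of a polygon is known only between the knots t i, which form a
    null set. *)
Lemma piecewise_integral (f : R -> \bar R) (c : nat -> R -> R) (t : nat -> R) n :
  (forall i, t i <= t i.+1) -> (forall i, continuous (c i)) ->
  (forall x, (0 <= f x)%E) ->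
  (forall i x, (i < n)%N -> t i < x < t i.+1 -> f x = (c i x)%:E) ->
  measurable_fun `[t 0%N, t n]%classic f /\
  (\int[leb]_(x in `[t 0%N, t n]) f x =
   \sum_(i < n) \int[leb]_(x in `[t i, t i.+1]) (c i x)%:E)%E.
Proof.
move=> tnd cc f0; elim: n => [|n IH] fc.
  rewrite big_ord0 set_itv1 integral_set1; split => //.
  exact: measurable_fun_set1.
have [] := IH; first by move=> i x il; apply: fc; exact: ltnW.
move=> mf fE.
have t0n : t 0%N <= t n by elim: (n) => // k /le_trans; apply.
have coo : {in `]t n, t n.+1[%classic, f =1 (EFin \o c n)}.
  by move=> x; rewrite inE/= in_itv/= => xt; exact: fc.
have mcoo : measurable_fun `]t n, t n.+1[%classic (EFin \o c n).
  apply/measurable_EFinP; apply: measurable_funTS.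
  exact: continuous_measurable_fun.
have mfoo : measurable_fun `]t n, t n.+1[%classic f.
  by apply: eq_measurable_fun mcoo => x xt; rewrite coo.
have mfn : measurable_fun `[t n, t n.+1]%classic f.
  exact: (emeasurable_fun_itv_cc (b0 := false) (b1 := true)).
have mf1 : measurable_fun `[t 0%N, t n.+1]%classic f.
  have -> : `[t 0%N, t n.+1]%classic = `[t 0%N, t n]%classic `|` `[t n, t n.+1]%classic.
    apply/seteqP; split => x /=; rewrite !in_itv/=; last first.
      by case=> /andP[? ?]; apply/andP; split => //;
        [exact: le_trans (tnd n)|exact: le_trans t0n _].
    by case: (leP x (t n)) => xn /andP[t0x xn1]; [left|right]; rewrite ?t0x ?(ltW xn).
  by apply/measurable_funU.
split => //; rewrite (integral_itv_cat _ _ (t n))// fE big_ord_recr/=.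
congr (_ + _)%E; rewrite (integral_itv_bndoo true false)//.
rewrite [RHS](integral_itv_bndoo true false)//.
by apply: eq_integral => x xt; exact: coo.
Qed.

End piecewise_integral.

Section clamp.
Context {R : realType}.

Definition clamp (s : R) : R := Num.max 0 (Num.min 1 s).

Lemma clamp_le0 s : s <= 0 -> clamp s = 0.
Proof. by move=> s0; rewrite /clamp min_r ?max_l//; lra. Qed.

Lemma clamp_ge1 s : 1 <= s -> clamp s = 1.
Proof. by move=> s1; rewrite /clamp min_l// max_r. Qed.

Lemma clamp_id s : 0 <= s <= 1 -> clamp s = s.
Proof. by move=> /andP[s0 s1]; rewrite /clamp min_r// max_r. Qed.

Lemma clamp_itv s : 0 <= clamp s <= 1.
Proof. by rewrite /clamp le_max lexx/= ge_max ler01 ge_min lexx. Qed.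

Lemma clamp_lip s t : `|clamp s - clamp t| <= `|s - t|.
Proof.
wlog st : s t / s <= t => [h|].
  by have [/h//|/ltW/h] := leP s t; rewrite distrC (distrC t).
rewrite (distrC s) (distrC (clamp s)) (ger0_norm (_ : 0 <= t - s)) ?subr_ge0//.
rewrite /clamp; case: (leP 1 t) => ?; case: (leP 1 s) => ?;
  do !case: (leP 0 _) => ?; rewrite ler_norml; apply/andP; split; lra.
Qed.

End clamp.

Lemma enorm_lip_path_continuous (R : realType) (d : nat) (gamma : R -> 'rV[R]_d)
  (k : R) : (forall s t, enorm (gamma s - gamma t) <= k * `|s - t|) ->
  continuous gamma.
Proof.
move=> gl x; apply/(@cvgrPdist_lt _ _ _ (nbhs x)) => e e0.
have k1 : 0 < `|k| + 1 by rewrite ltr_wpDl.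
near=> y.
apply: le_lt_trans (mx_norm_le_enorm _) _; apply: le_lt_trans (gl _ _) _.
apply: (@le_lt_trans _ _ ((`|k| + 1) * `|x - y|)).
  by rewrite ler_wpM2r// (le_trans (ler_norm k))// lerDl.
rewrite mulrC -ltr_pdivlMr//; near: y.
by apply: (@cvgr_dist_lt _ _ _ (nbhs x) _ id) => //; rewrite divr_gt0.
Unshelve. all: by end_near. Qed.

Section polygon.
Context {R : realType} {d : nat}.
Variables (n : nat) (v : nat -> 'rV[R]_d).
Hypothesis n0 : (0 < n)%N.

(** The polygon with vertices v 0, ..., v n, reached at the times i / n. *)
Definition polygon (t : R) : 'rV[R]_d :=
  v 0%N + \sum_(k < n) clamp (n%:R * t - k%:R) *: (v k.+1 - v k).

Lemma polygon_seg i t : (i < n)%N -> i%:R <= n%:R * t <= i.+1%:R ->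
  polygon t = seg (v i) (v i.+1) (n%:R * t - i%:R).
Proof.
move=> il /andP[it ti].
have tele j : v 0%N + \sum_(k < j) (v k.+1 - v k) = v j.
  elim: j => [|j IH]; first by rewrite big_ord0 addr0.
  by rewrite big_ord_recr/= addrA IH addrC subrK.
rewrite /polygon -(big_mkord xpredT (fun k => clamp (n%:R * t - k%:R) *: (v k.+1 - v k))).
rewrite (@big_cat_nat _ _ _ i 0 n)//=; last exact: ltnW.
rewrite (big_ltn il) [X in _ + (_ + (_ + X))]big1_seq; last first.
  move=> k; rewrite mem_index_iota => /andP[_ /andP[ik _]].
  have : i.+1%:R <= k%:R :> R by rewrite ler_nat.
  by move=> ?; rewrite clamp_le0 ?scale0r//; lra.
rewrite addr0 (eq_big_nat _ _ (F2 := fun k => v k.+1 - v k)); last first.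
  move=> k /andP[_ ki]; have : k.+1%:R <= i%:R :> R by rewrite ler_nat.
  by rewrite -natr1 => ?; rewrite clamp_ge1 ?scale1r//; lra.
rewrite big_mkord addrA tele clamp_id//.
by move: ti; rewrite -natr1 => ?; apply/andP; split; lra.
Qed.

Lemma polygon_vertex i : (i <= n)%N -> polygon (i%:R / n%:R) = v i.
Proof.
have nn : n%:R != 0 :> R by rewrite pnatr_eq0 -lt0n.
have E j : n%:R * (j%:R / n%:R) = j%:R :> R by rewrite mulrCA mulfV// mulr1.
case: i => [|i] il.
  by rewrite (polygon_seg 0)// E ?subr0 ?seg0// lexx ler_nat.
rewrite (polygon_seg i)// E; last by rewrite ler_nat leqnSn/=.
by rewrite -natr1 addrAC subrr add0r seg1.
Qed.

Lemma polygon_lip s t : enorm (polygon s - polygon t) <=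
  (\sum_(k < n) enorm (v k.+1 - v k)) * n%:R * `|s - t|.
Proof.
have -> : polygon s - polygon t = \sum_(k < n)
    (clamp (n%:R * s - k%:R) - clamp (n%:R * t - k%:R)) *: (v k.+1 - v k).
  rewrite /polygon opprD addrACA subrr add0r -sumrB.
  by apply: eq_bigr => k _; rewrite scalerBl.
apply: le_trans (enorm_sum n (fun k =>
  (clamp (n%:R * s - k%:R) - clamp (n%:R * t - k%:R)) *: (v k.+1 - v k))) _.
rewrite -mulrA mulr_suml; apply: ler_sum => k _; rewrite enormZ mulrC.
rewrite ler_wpM2l ?enorm_ge0// (le_trans (clamp_lip _ _))//.
by rewrite opprB addrA subrK -mulrBr normrM ger0_norm.
Qed.

Lemma polygon_derive i t : (i < n)%N -> i%:R < n%:R * t < i.+1%:R ->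
  derive1 polygon t = n%:R *: (v i.+1 - v i).
Proof.
move=> il /andP[it ti].
have ngt0 : 0 < n%:R :> R by rewrite ltr0n.
pose A (s : R) := seg (v i) (v i.+1) (n%:R * s - i%:R).
have nearE : \near t, A t = polygon t.
  near=> s; rewrite (polygon_seg i)//; apply/andP; split; apply: ltW.
    rewrite mulrC -ltr_pdivrMr//; near: s; apply: lt_nbhsr.
    by rewrite ltr_pdivrMr// mulrC.
  rewrite mulrC -ltr_pdivlMr//; near: s; apply: lt_nbhsl.
  by rewrite ltr_pdivlMr// mulrC.
rewrite derive1E -(near_eq_derive (1 : R^o) nearE).
have H : h^-1 *: (A (h *: (1 : R^o) + t) - A t) @[h --> (0 : R)^'] -->
    n%:R *: (v i.+1 - v i).
  apply: cvg_near_cst; near=> h.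
  have h0 : h != 0 by near: h; exact: nbhs_dnbhs_neq.
  rewrite /A/= seg_sub scalerA; congr (_ *: _).
  by rewrite /GRing.scale/= mulr1; field.
exact: (cvg_lim (@norm_hausdorff _ _) H).
Unshelve. all: by end_near. Qed.

End polygon.

Section polygon_path.
Context {R : realType} {d : nat} {m p beta Delta : R} {N : nat}.
Context {K : set 'rV[R]_d} {mu : probability (borel_rV R d) R}.
Context {g : 'rV[R]_d -> R}.
Hypothesis W : tame_weight beta Delta N K g.
Hypothesis dtmE : forall x, dtm m p mu x = (g x)%:E.
Local Notation leb := (@lebesgue_measure R).
Local Notation scost := (segcost beta g).

Lemma fdtm_lengthE (gamma : R -> 'rV[R]_d) : fdtm_length m p beta mu gamma =
  (\int[leb]_(t in `[0%R, 1%R])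
     (g (gamma t) `^ beta * enorm (derive1 gamma t))%:E)%E.
Proof.
rewrite /fdtm_length; apply: eq_integral => t _.
by rewrite dtmE poweR_EFin EFinM.
Qed.

Context (F : set 'rV[R]_d) (n : nat) (v : nat -> 'rV[R]_d).
Hypotheses (n0 : (0 < n)%N) (v_F : forall i, (0 < i < n)%N -> F (v i)).

Let nR0 : 0 < n%:R :> R. Proof. by rewrite ltr0n. Qed.

Let knot (i : nat) : R := i%:R / n%:R.

Let knot0 : knot 0 = 0. Proof. by rewrite /knot mul0r. Qed.

Let knotn : knot n = 1. Proof. by rewrite /knot mulfV// gt_eqF. Qed.

Let knot_nd i : knot i <= knot i.+1.
Proof. by rewrite ler_wpM2r ?invr_ge0 ?(ltW nR0)// ler_nat. Qed.

Let knotE i t : (knot i < t < knot i.+1) = (i%:R < n%:R * t < i.+1%:R).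
Proof. by rewrite /knot ltr_pdivrMr// ltr_pdivlMr// mulrC. Qed.

Lemma polygon_path_length :
  (path_length (polygon n v) < +oo)%E.
Proof.
have [] := @piecewise_integral R
  (fun t => (enorm (derive1 (polygon n v) t))%:E)
  (fun i => cst (enorm (n%:R *: (v i.+1 - v i)))) knot n.
- exact: knot_nd.
- by move=> i; exact: cst_continuous.
- by move=> t; rewrite lee_fin enorm_ge0.
- by move=> i t il; rewrite knotE => /(polygon_derive _ _ n0 _ _ il) ->.
rewrite knot0 knotn => _; rewrite /path_length => ->.
rewrite lte_sum_pinfty// => i _.
rewrite (eq_integral (cst (enorm (n%:R *: (v i.+1 - v i)))%:E))//.
rewrite integral_cst//= lebesgue_measure_itv/=.
by case: ifP => _; rewrite ?mule0// -EFinB -EFinM ltry.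
Qed.

Lemma polygon_fdtm_length : fdtm_length m p beta mu (polygon n v) =
  (\sum_(k < n) scost (v k) (v k.+1))%:E.
Proof.
rewrite fdtm_lengthE.
pose c (i : nat) (t : R) := g (seg (v i) (v i.+1) (n%:R * t - i%:R)) `^ beta *
  (n%:R * enorm (v i.+1 - v i)).
have cc i : continuous (c i).
  have ac : continuous (fun t : R => n%:R * t - i%:R).
    move=> t; apply: cvgB; last exact: cvg_cst.
    by apply: cvgM; [exact: cvg_cst|exact: cvg_id].
  move=> t; apply: (@cvgM _ _ (nbhs t) _ (fun t : R =>
    g (seg (v i) (v i.+1) (n%:R * t - i%:R)) `^ beta) (cst _)); last exact: cvg_cst.
  apply: (@continuous_comp R R R (fun t => n%:R * t - i%:R)
    (fun s => g (seg (v i) (v i.+1) s) `^ beta) t); first exact: ac.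
  exact: (tame_seg_continuous W).
have [] := @piecewise_integral R
  (fun t => (g (polygon n v t) `^ beta * enorm (derive1 (polygon n v) t))%:E)
  c knot n.
- exact: knot_nd.
- exact: cc.
- by move=> t; rewrite lee_fin mulr_ge0 ?powR_ge0 ?enorm_ge0.
- move=> i t il; rewrite knotE => ti.
  rewrite (polygon_derive _ _ n0 i)// enormZ ger0_norm ?(ltW nR0)//.
  by rewrite (polygon_seg _ _ i)//; case/andP: ti => /ltW -> /ltW ->.
rewrite knot0 knotn => _ ->; rewrite -sumEFin; apply: eq_bigr => i _.
have ki : knot i < knot i.+1.
  by rewrite /knot ltr_pM2r ?invr_gt0// ltr_nat.
have := Rintegral_affine (c i) _ _ (cc i) ki.
have kd : knot i.+1 - knot i = n%:R^-1.
  by rewrite /knot -mulrBl -natr1 addrAC subrr add0r mul1r.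
rewrite kd /Rintegral => E.
rewrite -[LHS]fineK; last first.
  by apply: integrable_fin_num => //; exact: continuous_integrable_itv (cc i).
rewrite E; congr EFin.
rewrite -[fine _]/(\int[leb]_(x in `[0%R, 1%R]) c i (knot i + n%:R^-1 * x)).
rewrite (@eq_Rintegral _ _ _ leb _ (fun x => n%:R * enorm (v i.+1 - v i) *
    g (seg (v i) (v i.+1) x) `^ beta)); last first.
  move=> x _; rewrite /c mulrC; congr (_ * g (seg _ _ _) `^ _).
  by rewrite /knot; field; rewrite gt_eqF.
rewrite RintegralZl//; last first.
  exact: continuous_integrable_itv (tame_seg_continuous W _ _).
by rewrite /segcost segmeanE mulrA mulrA mulVf ?mul1r// gt_eqF.
Qed.

(** An interval of times during which the polygon avoids F has no knot inside,
    so that it is spent on a single segment. *)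
Lemma polygon_straight : (exists u : 'rV[R]_d, enorm u = 1) ->
  straight_outside F (polygon n v).
Proof.
move=> [u0 u01] a b a0 ab b1 abF.
pose c := (a + b) / 2.
have ac : a < c by rewrite /c; lra.
have cb : c < b by rewrite /c; lra.
have nc0 : 0 <= n%:R * c by rewrite mulr_ge0 ?(ltW nR0)//; lra.
pose i := Num.truncn (n%:R * c).
have /andP[ic ci] : i%:R <= n%:R * c < i.+1%:R by rewrite truncn_itv.
have il : (i < n)%N.
  rewrite -(ltr_nat R) (le_lt_trans ic)// gtr_pMr//; lra.
have noF j : (0 < j < n)%N -> ~ (a < knot j < b).
  move=> jn jab; apply: (abF (knot j)); first by rewrite in_itv.
  by rewrite polygon_vertex//; [exact: v_F|case/andP: jn => _ /ltnW].
have ia : knot i <= a.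
  rewrite leNgt; apply/negP => ai; apply: (noF i).
    rewrite il andbT lt0n; apply/eqP => i0.
    by move: ai; rewrite i0 knot0; lra.
  by rewrite ai (le_lt_trans _ cb)// ler_pdivrMr// mulrC.
have bi : b <= knot i.+1.
  rewrite leNgt; apply/negP => ib; apply: (noF i.+1).
    rewrite /= ltn_neqAle il andbT; apply/eqP => iN.
    by move: ib; rewrite iN knotn; lra.
  by rewrite ib andbT (lt_trans ac)// ltr_pdivlMr// mulrC.
have der t : t \in `]a, b[ -> derive1 (polygon n v) t = n%:R *: (v i.+1 - v i).
  rewrite in_itv/= => /andP[at_ tb]; apply: polygon_derive => //.
  by rewrite -knotE (le_lt_trans ia at_) (lt_le_trans tb bi).
have [v0|v0] := eqVneq (enorm (v i.+1 - v i)) 0.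
  exists u0; split => // t tab _; rewrite der// enormZ v0 mulr0 scale0r.
  by rewrite (enorm_eq0 _ v0) scaler0.
exists ((enorm (v i.+1 - v i))^-1 *: (v i.+1 - v i)); split.
  by rewrite enormZ ger0_norm ?invr_ge0 ?enorm_ge0// mulVf.
move=> t tab _; rewrite der// enormZ ger0_norm ?(ltW nR0)//.
by rewrite scalerA -mulrA mulfV// mulr1.
Qed.

Lemma polygon_Gamma : (exists u : 'rV[R]_d, enorm u = 1) ->
  Gamma_paths F (v 0%N) (v n) (polygon n v).
Proof.
move=> ex_u; split.
- split; last exact: polygon_path_length.
    apply: continuous_subspaceT.
    exact: (enorm_lip_path_continuous _ _ _ _ (polygon_lip n v)).
  by eexists => s t _ _; exact: polygon_lip.
- by rewrite -(mul0r n%:R^-1) (polygon_vertex n v n0 0).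
- by rewrite -knotn polygon_vertex.
- exact: polygon_straight.
Qed.

End polygon_path.

(** * Velocity of Lipschitz paths *)

Section ae_monotone.
Context {dsp : measure_display} {T : measurableType dsp} {R : realType}.
Context (mu : {measure set T -> \bar R}).
Local Open Scope ereal_scope.

(** The speed of a path, being a junk value where the derivative does not exist,
    has no evident measurability, but monotonicity extends to an arbitrary
    larger function: the integral of a nonnegative function is a supremum over
    the simple functions below it. *)
Lemma ge0_le_integral_ae (D : set T) (h f : T -> \bar R) : measurable D ->
  measurable_fun D h -> (forall x, D x -> 0 <= h x) -> (forall x, 0 <= f x) ->
  {ae mu, forall x, D x -> h x <= f x} ->
  \int[mu]_(x in D) h x <= \int[mu]_(x in D) f x.
Proof.
move=> mD mh h0 f0 [A [mA A0 hA]].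
rewrite (ge0_negligible_integral mA)//.
have h0' x : (D `\` A) x -> 0 <= h x by case=> /h0.
rewrite (ge0_integralE _ h0') (ge0_integralE mu (fun x (_ : D x) => f0 x)).
apply: ge_ereal_sup => _ [s sh <-]; apply: ereal_sup_ubound; exists s => // x.
apply: (le_trans (sh x)); rewrite !patchE; case: ifPn => [|_]; last first.
  by case: ifPn => // _; exact: f0.
rewrite inE => -[Dx Ax]; rewrite mem_set//; apply: contrapT => hf.
by apply: Ax; apply: hA => /(_ Dx).
Qed.

Local Close Scope ereal_scope.

Lemma integrable_scale (D : set T) (c : R) (f : T -> R) : measurable D ->
  mu.-integrable D (EFin \o f) -> mu.-integrable D (EFin \o (fun x => c * f x)).
Proof.
move=> mD fi; apply: (eq_integrable mD (fun x => c%:E * (EFin \o f) x)%E) => //.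
exact: integrableZl.
Qed.

Lemma Rintegral_lin_comb (D : set T) (n : nat) (q : 'I_n -> R) (f : 'I_n -> T -> R) :
  measurable D -> (forall i, mu.-integrable D (EFin \o f i)) ->
  mu.-integrable D (EFin \o (fun x => \sum_i q i * f i x)) /\
  \int[mu]_(x in D) (\sum_i q i * f i x) = \sum_i q i * \int[mu]_(x in D) f i x.
Proof.
move=> mD fi; elim: (index_enum _) => [|i s [IHi IHe]].
  split.
    by apply: (eq_integrable mD (cst 0%E)); [move=> x _; rewrite /= big_nil|exact: integrable0].
  rewrite big_nil (@eq_Rintegral _ _ _ _ _ (cst 0)) ?Rintegral_cst ?mul0r//.
  by move=> x _; rewrite big_nil.
have zi : mu.-integrable D (EFin \o (fun x => q i * f i x)).
  exact: integrable_scale.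
split.
  have -> : EFin \o (fun x => \sum_(j <- i :: s) q j * f j x) =
      ((EFin \o (fun x => q i * f i x)%R) \+
       (EFin \o (fun x => \sum_(j <- s) q j * f j x)%R))%E.
    by apply/funext => x /=; rewrite big_cons EFinD.
  exact: integrableD.
rewrite big_cons -IHe -RintegralZl// -RintegralD//.
by apply: eq_Rintegral => x _; rewrite big_cons.
Qed.

End ae_monotone.

Section interval_lemmas.
Context {R : realType}.
Local Notation leb := (@lebesgue_measure R).

Lemma ae_closed_itv (P : R -> Prop) (a b : R) :
  {ae leb, forall x, a < x < b -> P x} -> {ae leb, forall x, a <= x <= b -> P x}.
Proof.
move=> Pab.
have n1 c : leb.-negligible [set c].
  by exists [set c]; split => //; exact: lebesgue_measure_set1.
apply: (negligibleS _ (negligibleU Pab (negligibleU (n1 a) (n1 b)))).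
move=> x /= /not_implyP[/andP[ax bx] nPx].
have [->|xa] := eqVneq x a; first by right; left.
have [->|xb] := eqVneq x b; first by right; right.
left => h; apply: nPx; apply: h.
by rewrite !lt_neqAle eq_sym xa ax xb bx.
Qed.

End interval_lemmas.

Section lipschitz_path.
Context {R : realType} {d : nat}.
Local Notation leb := (@lebesgue_measure R).
Variables (gamma : R -> 'rV[R]_d) (k : R).
Hypothesis gamma_lip : forall s t, 0 <= s <= 1 -> 0 <= t <= 1 ->
  enorm (gamma s - gamma t) <= k * `|s - t|.

Lemma lipschitz_path_derivative : exists rho : R -> 'rV[R]_d,
  [/\ forall i, leb.-integrable [set: R] (EFin \o (fun t => rho t ord0 i)),
    forall s t i, 0 <= s -> s <= t -> t <= 1 ->
      gamma t ord0 i - gamma s ord0 i = \int[leb]_(x in `[s, t]) rho x ord0 i &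
    {ae leb, forall t, 0 <= t <= 1 -> derivable gamma t 1 /\ derive1 gamma t = rho t}].
Proof.
have coord i : exists rho : R -> R, [/\ leb.-integrable [set: R] (EFin \o rho),
    forall s t, 0 <= s -> s <= t -> t <= 1 ->
      gamma t ord0 i - gamma s ord0 i = \int[leb]_(x in `[s, t]) rho x &
    {ae leb, forall t, 0 < t < 1 -> derivable (fun t => gamma t ord0 i) t 1 /\
      derive1 (fun t => gamma t ord0 i) t = rho t}].
  apply: (@lipschitz_ftc R (fun t => gamma t ord0 i) k) => // s t s01 t01.
  apply: le_trans (gamma_lip _ _ s01 t01).
  by apply: le_trans (coord_le_enorm _ i); rewrite !mxE.
have [rho rhoP] := choice coord.
exists (fun t => \row_i rho i t); split.
- move=> i; have [+ _ _] := rhoP i; apply: eq_integrable => // t _ /=.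
  by rewrite mxE.
- move=> s t i s0 st t1; have [_ + _] := rhoP i => ->//.
  by apply: eq_Rintegral => x _; rewrite mxE.
apply: ae_closed_itv.
have : {ae leb, forall t, forall i, 0 < t < 1 ->
    derivable (fun t => gamma t ord0 i) t 1 /\
    derive1 (fun t => gamma t ord0 i) t = rho i t}.
  by apply: filter_forall => i; have [] := rhoP i.
apply: filterS; first exact: (ae_filter_ringOfSetsType leb).
move=> t tP t01.
have dt : derivable gamma t 1.
  by apply/derivable_mxP => i j; rewrite (ord1 i); have [] := tP j t01.
split => //; rewrite derive1E (derive_mx dt).
apply/rowP => i; rewrite !mxE -derive1E; by have [] := tP i t01.
Qed.

End lipschitz_path.

Section path_speed.
Context {R : realType} {d : nat}.
Local Notation leb := (@lebesgue_measure R).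
Variables (gamma rho : R -> 'rV[R]_d).
Hypothesis rho_int : forall i, leb.-integrable [set: R] (EFin \o (fun t => rho t ord0 i)).
Hypothesis rho_ftc : forall s t i, 0 <= s -> s <= t -> t <= 1 ->
  gamma t ord0 i - gamma s ord0 i = \int[leb]_(x in `[s, t]) rho x ord0 i.
Hypothesis rho_ae : {ae leb, forall t, 0 <= t <= 1 ->
  derivable gamma t 1 /\ derive1 gamma t = rho t}.
Hypothesis gamma_length : (path_length gamma < +oo)%E.

Definition speed (t : R) : R := enorm (rho t).

Lemma speed_measurable : measurable_fun [set: R] speed.
Proof.
apply: (measurableT_comp (continuous_measurable_fun (@sqrt_continuous R))).
apply: measurable_sum => i; apply: measurable_funX.
by apply/measurable_EFinP; exact: measurable_int (rho_int i).
Qed.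

Lemma speed_integrable s t : 0 <= s -> t <= 1 ->
  leb.-integrable `[s, t] (EFin \o speed).
Proof.
move=> s0 t1.
have : leb.-integrable `[0, 1] (EFin \o speed).
  apply/integrableP; split.
    by apply/measurable_EFinP; apply: measurable_funTS; exact: speed_measurable.
  apply: le_lt_trans gamma_length.
  apply: ge0_le_integral_ae => //.
  - apply: measurableT_comp => //; apply/measurable_EFinP.
    by apply: measurable_funTS; exact: speed_measurable.
  - by move=> x; rewrite lee_fin enorm_ge0.
  move: rho_ae; apply: filterS; first exact: (ae_filter_ringOfSetsType leb).
  move=> x h; rewrite /= in_itv/= => /h[_ ->].
  by rewrite ger0_norm// enorm_ge0.
apply: integrableS => //.
by move=> x /=; rewrite !in_itv/= => /andP[sx xt]; rewrite (le_trans s0)// (le_trans xt).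
Qed.

(** The chord q satisfies |q| ^ 2 = int <q, rho> <= |q| int |rho|. *)
Lemma chord_le_speed s t : 0 <= s -> s <= t -> t <= 1 ->
  enorm (gamma t - gamma s) <= \int[leb]_(x in `[s, t]) speed x.
Proof.
move=> s0 st t1; set q := gamma t - gamma s.
have mst : measurable (`[s, t]%classic : set R) by exact: measurable_itv.
have [q0|q0] := eqVneq (enorm q) 0.
  by rewrite q0; apply: Rintegral_ge0 => x _; exact: enorm_ge0.
have qgt0 : 0 < enorm q by rewrite lt_neqAle eq_sym q0 enorm_ge0.
rewrite -(ler_pM2l qgt0) -expr2 enorm_sqr.
have fi i : leb.-integrable `[s, t] (EFin \o (fun x => rho x ord0 i)).
  exact: integrableS (rho_int i).
have [li le] := Rintegral_lin_comb leb _ _ (fun i => q ord0 i) _ mst fi.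
have -> : dotv q q = \sum_i q ord0 i * \int[leb]_(x in `[s, t]) rho x ord0 i.
  by apply: eq_bigr => i _; rewrite -rho_ftc// {2}/q !mxE.
rewrite -le -RintegralZl//; last exact: speed_integrable.
apply: le_Rintegral => //.
  by apply: integrable_scale => //; exact: speed_integrable.
by move=> x _; exact: dotv_le.
Qed.

(** On a stretch where the velocity keeps a fixed direction u, the path moves
    monotonically along the line of direction u. *)
Lemma straight_path s t u : 0 <= s -> s < t -> t <= 1 ->
  (forall x, x \in `]s, t[ -> derivable gamma x 1 ->
     derive1 gamma x = enorm (derive1 gamma x) *: u) ->
  forall x, s <= x <= t ->
  gamma x = gamma s + (\int[leb]_(y in `[s, x]) speed y) *: u.
Proof.
move=> s0 st t1 hu x /andP[sx xt].
suff E i : gamma x ord0 i - gamma s ord0 i =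
    (\int[leb]_(y in `[s, x]) speed y) * u ord0 i.
  by apply/rowP => i; rewrite !mxE -E addrC subrK.
rewrite rho_ftc ?(le_trans xt)// mulrC -RintegralZl//; last first.
  exact: speed_integrable (le_trans xt t1).
rewrite /Rintegral; congr fine.
have ms : measurable_fun [set: R] speed := speed_measurable.
apply: ae_eq_integral => //.
- apply/measurable_EFinP; apply: measurable_funTS.
  by apply/measurable_EFinP; exact: measurable_int (rho_int i).
- apply/measurable_EFinP; apply: measurable_funM => //.
  exact: measurable_funTS.
have st_ae : {ae leb, forall y, s < y < x -> rho y = speed y *: u}.
  move: rho_ae; apply: filterS; first exact: (ae_filter_ringOfSetsType leb).
  move=> y h /andP[sy yx].
  have [|dy E] := h.
    by rewrite (le_trans s0 (ltW sy)) (le_trans (ltW yx))// (le_trans xt).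
  rewrite /speed -E; apply: hu => //.
  by rewrite in_itv/= sy (lt_le_trans yx).
have := ae_closed_itv _ _ _ st_ae.
apply: filterS; first exact: (ae_filter_ringOfSetsType leb).
move=> y h; rewrite /= in_itv/= => /h ->.
by rewrite mxE mulrC.
Qed.

End path_speed.

(** * From paths to chains *)

Section path_subdivision.
Context {R : realType} {d : nat}.
Context {beta Delta : R} {N : nat} {K : set 'rV[R]_d} {g : 'rV[R]_d -> R}.
Hypothesis W : tame_weight beta Delta N K g.
Local Notation leb := (@lebesgue_measure R).
Local Notation scost := (segcost beta g).
Local Notation chain := (chain (beta := beta) (g := g)).
Variables (gamma rho : R -> 'rV[R]_d) (k : R) (F : set 'rV[R]_d).
Hypotheses (k0 : 0 <= k) (F_closed : closed F) (F_K : F `<=` K).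
Hypothesis gamma_lip : forall s t, 0 <= s <= 1 -> 0 <= t <= 1 ->
  enorm (gamma s - gamma t) <= k * `|s - t|.
Hypothesis rho_int : forall i, leb.-integrable [set: R] (EFin \o (fun t => rho t ord0 i)).
Hypothesis rho_ftc : forall s t i, 0 <= s -> s <= t -> t <= 1 ->
  gamma t ord0 i - gamma s ord0 i = \int[leb]_(x in `[s, t]) rho x ord0 i.
Hypothesis rho_ae : {ae leb, forall t, 0 <= t <= 1 ->
  derivable gamma t 1 /\ derive1 gamma t = rho t}.
Hypothesis gamma_length : (path_length gamma < +oo)%E.
Hypothesis gamma_straight : straight_outside F gamma.

Let sp := speed rho.

Let gammac t := gamma (clamp t).

Let gammac_continuous : continuous gammac.
Proof.
apply: (enorm_lip_path_continuous _ _ _ k) => s t.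
by rewrite (le_trans (gamma_lip _ _ (clamp_itv s) (clamp_itv t)))// ler_wpM2l ?clamp_lip.
Qed.

(** The density along the path; the clamp only makes it continuous on R. *)
Definition path_weight t : R := g (gamma (clamp t)) `^ beta.

Lemma path_weight_continuous : continuous path_weight.
Proof.
move=> t; apply: (@continuous_comp _ _ _ gammac (fun x => g x `^ beta)).
  exact: gammac_continuous.
exact: (tame_weight_continuous W).
Qed.

Context (kap : R).
Hypothesis kap0 : 0 <= kap.

(** The term kap makes up for the variation of the density along the short
    pieces that chords replace. *)
Definition path_cost (s t : R) : \bar R :=
  (\int[leb]_(x in `[s, t]) ((path_weight x + kap) * sp x)%:E)%E.

Let dens_ge0 x : 0 <= (path_weight x + kap) * sp x.
Proof. by rewrite mulr_ge0 ?enorm_ge0// addr_ge0 ?powR_ge0. Qed.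

Let dens_measurable : measurable_fun [set: R] (fun x => (path_weight x + kap) * sp x).
Proof.
apply: measurable_funM; last exact: (speed_measurable rho rho_int).
apply: measurable_funD => //; apply: continuous_measurable_fun.
exact: path_weight_continuous.
Qed.

Lemma path_cost_cat a b c : a <= b -> b <= c ->
  (path_cost a c = path_cost a b + path_cost b c)%E.
Proof.
move=> ab bc; apply: integral_itv_cat => //.
- by apply/measurable_EFinP; exact: measurable_funTS.
- by move=> x _; rewrite lee_fin dens_ge0.
Qed.

Lemma path_cost_ge0 a b : (0 <= path_cost a b)%E.
Proof. by apply: integral_ge0 => x _; rewrite lee_fin dens_ge0. Qed.

Lemma segcost_le_path_cost s t : 0 <= s -> s <= t -> t <= 1 ->
  (forall x, s <= x <= t -> segmean beta g (gamma s) (gamma t) <= path_weight x + kap) ->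
  ((scost (gamma s) (gamma t))%:E <= path_cost s t)%E.
Proof.
move=> s0 st t1 h; set M := segmean beta g (gamma s) (gamma t) in h *.
have M0 : 0 <= M by exact: segmean_ge0.
have i1 := speed_integrable gamma rho rho_int rho_ae gamma_length s t s0 t1.
have i2 : leb.-integrable `[s, t] (EFin \o (fun x => M * sp x)).
  exact: integrable_scale.
apply: (@le_trans _ _ (\int[leb]_(x in `[s, t]) (M * sp x))%:E).
  rewrite lee_fin RintegralZl// /segcost -/M mulrC ler_wpM2l//.
  exact: (chord_le_speed gamma rho rho_int rho_ftc rho_ae gamma_length).
rewrite /Rintegral fineK; last by apply: integrable_fin_num i2.
apply: ge0_le_integral => //.
- by move=> x _; rewrite lee_fin mulr_ge0 ?enorm_ge0.
- by apply: measurable_int i2.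
- by apply/measurable_EFinP; exact: measurable_funTS.
move=> x; rewrite /= in_itv/= => xst; rewrite lee_fin ler_wpM2r ?enorm_ge0//.
exact: h.
Qed.

Context (r : R).
Hypotheses (r0 : 0 <= r) (kapE : kap = beta * Delta `^ (beta - 1) * (2 * r)).

(** Path and chord stay within r of gamma s, so that g differs by at most 2 r
    between a point of one and a point of the other. *)
Lemma short_path_cost s t : 0 <= s -> s <= t -> t <= 1 -> k * (t - s) <= r ->
  K (gamma s) -> K (gamma t) -> ((scost (gamma s) (gamma t))%:E <= path_cost s t)%E.
Proof.
move=> s0 st t1 str Ks Kt; apply: segcost_le_path_cost => // x /andP[sx xt].
have lip u v : s <= u <= t -> s <= v <= t -> enorm (gamma u - gamma v) <= r.
  move=> /andP[su ut] /andP[sv vt].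
  have u01 : 0 <= u <= 1 by rewrite (le_trans s0) ?(le_trans ut).
  have v01 : 0 <= v <= 1 by rewrite (le_trans s0) ?(le_trans vt).
  apply: le_trans (gamma_lip _ _ u01 v01) (le_trans _ str).
  by rewrite ler_wpM2l// ler_norml; apply/andP; split; lra.
apply: (segmean_le W) => y y01.
rewrite /path_weight clamp_id; last by rewrite (le_trans s0 sx) (le_trans xt).
rewrite kapE; apply: powR_le_add.
- exact: (tw_beta _ _ _ _ _ W).
- exact: (tw_ge0 _ _ _ _ _ W).
- exact: (tw_ge0 _ _ _ _ _ W).
- by rewrite mulr_ge0.
- apply: (le_trans (tw_lip _ _ _ _ _ W _ (gamma x))); rewrite lerD2l.
  apply: (le_trans (enorm_triangle (gamma s) _ _)).
  rewrite [leRHS]mulr_natl mulr2n lerD//; last by apply: lip; rewrite ?lexx ?sx ?st.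
  case/andP: y01 => y0 y1.
  rewrite -[X in _ - X](seg0 (gamma s) (gamma t)) enorm_seg_sub subr0 ger0_norm//.
  apply: (@le_trans _ _ (enorm (gamma t - gamma s))).
    by rewrite ler_piMl ?enorm_ge0.
  by apply: lip; rewrite ?lexx ?st.
- exact: (tw_le _ _ _ _ _ W _ (tw_seg _ _ _ _ _ W _ _ _ Ks Kt y01)).
Qed.

(** A straight stretch is cut into short pieces; on each the chord is cheap
    enough, and the chords add up because they lie on one segment. *)
Lemma straight_path_cost s t : 0 <= s -> s < t -> t <= 1 -> 0 < r ->
  K (gamma s) -> K (gamma t) -> (forall x, x \in `]s, t[ -> ~ F (gamma x)) ->
  ((scost (gamma s) (gamma t))%:E <= path_cost s t)%E.
Proof.
move=> s0 st t1 rgt0 Ks Kt stF.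
have [u [_ hu]] := gamma_straight s t s0 st t1 stF.
have lin := straight_path gamma rho rho_int rho_ftc rho_ae gamma_length s t u s0 st t1 hu.
pose L x := \int[leb]_(y in `[s, x]) sp y.
have L0 x : 0 <= L x by apply: Rintegral_ge0 => y _; exact: enorm_ge0.
have Lnd x y : s <= x -> x <= y -> y <= t -> L x <= L y.
  move=> sx xy yt; have yi := speed_integrable gamma rho rho_int rho_ae gamma_length
    s y s0 (le_trans yt t1).
  have := @Rintegral_itvB R sp (BLeft s) (BRight y) x yi.
  rewrite !bnd_simp => /(_ sx xy) E.
  rewrite -subr_ge0 /L E; apply: Rintegral_ge0 => z _; exact: enorm_ge0.
(* a point of the path on the segment to a later one *)
have on_seg x y : s <= x -> x <= y -> y <= t ->
    exists2 l, 0 <= l <= 1 & gamma x = seg (gamma s) (gamma y) l.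
  move=> sx xy yt; have sy := le_trans sx xy.
  rewrite (lin x) ?sx ?(le_trans xy)// (lin y) ?sy// -/(L x) -/(L y).
  have [Ly0|Ly0] := eqVneq (L y) 0.
    exists 0; first by rewrite lexx ler01.
    rewrite seg0 (_ : L x = 0) ?scale0r ?addr0//.
    by apply/eqP; rewrite eq_le L0 andbT -Ly0 Lnd.
  have Lyp : 0 < L y by rewrite lt_neqAle eq_sym Ly0 L0.
  exists (L x / L y).
    by rewrite divr_ge0//= ler_pdivrMr// mul1r Lnd.
  by rewrite /seg addrAC subrr add0r scalerA mulrAC -mulrA mulfV// mulr1.
have Kx x : s <= x -> x <= t -> K (gamma x).
  move=> sx xt; have [l l01 ->] := on_seg x t sx xt (lexx _).
  exact: (tw_seg _ _ _ _ _ W).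
have [n nE] : exists n : nat, k * (t - s) <= n.+1%:R * r.
  exists (Num.truncn (k * (t - s) / r)).
  by rewrite -ler_pdivrMr// ltW// truncnS_gt.
pose h := (t - s) / n.+1%:R.
have h0 : 0 <= h by rewrite divr_ge0// subr_ge0 ltW.
have kh : k * h <= r by rewrite /h mulrA ler_pdivrMr// (mulrC r).
have hn : n.+1%:R * h = t - s by rewrite /h mulrCA mulfV ?mulr1// pnatr_eq0.
suff H j : (j <= n.+1)%N ->
    ((scost (gamma s) (gamma (s + j%:R * h)))%:E <= path_cost s (s + j%:R * h))%E.
  by have := H n.+1 (leqnn _); rewrite hn addrC subrK.
elim: j => [|j IH] jn.
  by rewrite mul0r addr0 /segcost subrr enorm0 mul0r path_cost_ge0.
have {}IH := IH (ltnW jn).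
set a := s + j%:R * h in IH *; set b := s + j.+1%:R * h.
have sa : s <= a by rewrite lerDl mulr_ge0.
have ba : b - a = h by rewrite /a /b -natr1; ring.
have ab : a <= b by rewrite -subr_ge0 ba.
have bt : b <= t.
  by rewrite /b -lerBrDl -hn ler_wpM2r// ler_nat.
have at_ := le_trans ab bt; have sb := le_trans sa ab.
have [l l01 la] := on_seg a b sa ab bt.
rewrite (segcost_split W _ _ l l01) -la EFinD (path_cost_cat s a b)//.
apply: leeD IH _; apply: short_path_cost => //.
- exact: le_trans sa.
- exact: le_trans t1.
- by rewrite ba.
- exact: Kx.
- exact: Kx.
Qed.

Definition link s t : Prop := exists n C L,
  chain F (gamma s) (gamma t) n C L /\ (C%:E <= path_cost s t)%E.

Lemma link_cat a b c : a <= b -> b <= c -> F (gamma b) ->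
  link a b -> link b c -> link a c.
Proof.
move=> ab bc Fb [n [C [L [ch Cle]]]] [n' [C' [L' [ch' C'le]]]].
exists (n + n')%N, (C + C'), (L + L'); split; first exact: chain_cat ch'.
by rewrite EFinD (path_cost_cat a b c)// leeD.
Qed.

Lemma link_segment s t :
  ((scost (gamma s) (gamma t))%:E <= path_cost s t)%E -> link s t.
Proof. by move=> h; do 3 eexists; split; [exact: Chain1|]. Qed.

Let time_max a b : 0 <= a -> b <= 1 ->
  (exists2 x, a <= x <= b & F (gamma x)) ->
  (exists2 x, a <= x <= b & F (gamma x) /\
     forall y, a <= y <= b -> F (gamma y) -> y <= x) /\
  (exists2 x, a <= x <= b & F (gamma x) /\
     forall y, a <= y <= b -> F (gamma y) -> x <= y).
Proof.
move=> a0 b1 [x0 x0ab Fx0].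
pose A : set R := `[a, b]%classic `&` gammac @^-1` F.
have AE y : A y <-> a <= y <= b /\ F (gamma y).
  rewrite /A /gammac /= in_itv/=; split => -[/[dup] yab /andP[ay yb]];
    by rewrite clamp_id// (le_trans a0 ay) (le_trans yb b1).
have A0 : A !=set0 by exists x0; apply: (AE _).2.
have cA : compact A.
  apply: (subclosed_compact _ (@segment_compact _ a b)); last by move=> y [].
  apply: closedI; first exact: itv_closed.
  by apply: closed_comp => // y _; exact: gammac_continuous.
have cid : {within A, continuous (id : R -> R)} by apply: continuous_subspaceT => y; exact: cvg_id.
split.
- have [x + xmax] := compact_EVT_max A0 cA cid; rewrite inE => /(AE _).1[xab Fx].
  by exists x => //; split => // y yab Fy; apply: xmax; rewrite inE; apply: (AE _).2.
- have [x + xmin] := compact_EVT_min A0 cA cid; rewrite inE => /(AE _).1[xab Fx].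
  by exists x => //; split => // y yab Fy; apply: xmin; rewrite inE; apply: (AE _).2.
Qed.

(** Vertices are the last time in F before s + delta and the first one after
    it: up to the former the path is short, between the two it is straight. *)
Lemma path_link : 0 < r -> K (gamma 0) -> K (gamma 1) -> link 0 1.
Proof.
move=> rgt0 K0 K1; pose delta := r / (k + 1).
have k1 : 0 < k + 1 by rewrite ltr_wpDl.
have d0 : 0 < delta by rewrite divr_gt0.
have kd : k * delta <= r.
  by rewrite /delta mulrA ler_pdivrMr// mulrC ler_wpM2l// lerDl.
have short s t : 0 <= s -> s <= t -> t <= 1 -> t - s <= delta ->
    K (gamma s) -> K (gamma t) -> link s t.
  move=> s0 st t1 std Ks Kt; apply/link_segment/short_path_cost => //.
  by apply: le_trans kd; rewrite ler_wpM2l.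
have straight s t : 0 <= s -> s <= t -> t <= 1 -> K (gamma s) -> K (gamma t) ->
    (forall x, s < x < t -> ~ F (gamma x)) -> link s t.
  move=> s0; rewrite le_eqVlt => /predU1P[<-|st] t1 Ks Kt stF.
    by apply: short => //; rewrite subrr ltW.
  by apply/link_segment/straight_path_cost => // x; rewrite in_itv/=; exact: stF.
have H j s t : 0 <= s -> s <= t -> t <= 1 -> t - s <= j%:R * delta ->
    K (gamma s) -> K (gamma t) -> link s t.
  elim: j s => [|j IH] s s0 st t1 stj Ks Kt.
    apply: short => //; apply: le_trans stj _.
    by rewrite mul0r ltW.
  have [std|std] := leP (t - s) delta; first exact: short.
  pose c := s + delta.
  have sc : s <= c by rewrite /c lerDl ltW.
  have ct : c <= t by rewrite /c -lerBrDl ltW.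
  have right s' : s <= s' -> s' <= c -> K (gamma s') ->
      (forall x, s' < x <= c -> ~ F (gamma x)) -> link s' t.
    move=> ss' s'c Ks' noF; have s'0 := le_trans s0 ss'.
    have [exF|nexF] := pselect (exists2 x, c <= x <= t & F (gamma x)).
      have [_ [x /andP[cx xt] [Fx xmin]]] := time_max c t (le_trans s0 sc) t1 exF.
      have s'x := le_trans s'c cx; have x0 := le_trans s'0 s'x.
      apply: (link_cat s' x t) => //.
        apply: straight => //; [exact: le_trans t1|exact: F_K|].
        move=> y /andP[s'y yx] Fy; have [yc|cy] := leP y c.
          by apply: (noF y) => //; rewrite s'y.
        have := xmin y; rewrite (ltW cy) (le_trans (ltW yx))// => /(_ isT Fy).
        by rewrite leNgt yx.
      apply: IH => //; last exact: F_K.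
      move: stj; rewrite -natr1 mulrDl mul1r.
      by move: cx; rewrite /c; move: (j%:R * _) => w; lra.
    apply: straight => //; first exact: le_trans s'c ct.
    move=> y /andP[s'y yt] Fy; have [yc|cy] := leP y c.
      by apply: (noF y) => //; rewrite s'y.
    by apply: nexF; exists y => //; rewrite !ltW.
  have [exF|nexF] := pselect (exists2 x, s <= x <= c & F (gamma x)).
    have [[x /andP[sx xc] [Fx xmax]] _] := time_max s c s0 (le_trans ct t1) exF.
    apply: (link_cat s x t) => //; first exact: le_trans xc ct.
      apply: short => //; [exact: le_trans xc (le_trans ct t1)| |exact: F_K].
      by rewrite lerBlDl.
    apply: right => //; first exact: F_K.
    move=> y /andP[xy yc] Fy; have := xmax y.
    by rewrite (le_trans sx (ltW xy)) yc => /(_ isT Fy); rewrite leNgt xy.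
  apply: right => // y /andP[sy yc] Fy; apply: nexF; exists y => //.
  by rewrite ltW.
apply: (H (Num.truncn (1 / delta)).+1) => //.
by rewrite subr0 -ler_pdivrMr// ltW// truncnS_gt.
Qed.

End path_subdivision.

(** * Comparison of Fermat distances *)

Section fermat_compare.
Context {R : realType} {d : nat} {m p beta Delta : R} {N : nat}.
Context {K : set 'rV[R]_d} {mu : probability (borel_rV R d) R}.
Context {g : 'rV[R]_d -> R}.
Hypothesis W : tame_weight beta Delta N K g.
Hypothesis dtmE : forall x, dtm m p mu x = (g x)%:E.
Hypothesis ex_unit : exists u : 'rV[R]_d, enorm u = 1.
Local Notation leb := (@lebesgue_measure R).
Local Notation chain := (chain (beta := beta) (g := g)).

(** The path has finite length, so a small enough kap raises its cost by at most
    e. *)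
Lemma path_chain (F : set 'rV[R]_d) x y (gamma : R -> 'rV[R]_d) (e : R) :
  closed F -> F `<=` K -> K x -> K y -> Gamma_paths F x y gamma -> 0 < e ->
  exists n C L, chain F x y n C L /\
    (C%:E <= fdtm_length m p beta mu gamma + e%:E)%E.
Proof.
move=> Fcl FK Kx Ky [[_ [k0 klip0] glen] g0 g1 gstr] e0.
pose k := `|k0|.
have klip s t : 0 <= s <= 1 -> 0 <= t <= 1 ->
    enorm (gamma s - gamma t) <= k * `|s - t|.
  move=> s01 t01; apply: (le_trans (klip0 s t _ _)); rewrite ?in_itv//.
  by rewrite ler_wpM2r// ler_norm.
have [rho [rho_int rho_ftc rho_ae]] := lipschitz_path_derivative gamma k klip.
have i1 := speed_integrable gamma rho rho_int rho_ae glen 0 1 (lexx _) (lexx _).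
have ms := speed_measurable rho rho_int.
pose B := \int[leb]_(t in `[0, 1]) speed rho t.
have B0 : 0 <= B by apply: Rintegral_ge0 => t _; exact: enorm_ge0.
have b0 := beta_ge0 W.
pose c0 := beta * Delta `^ (beta - 1) * 2 * B.
have c00 : 0 <= c0 by rewrite !mulr_ge0 ?powR_ge0.
have c1 : 0 < c0 + 1 by rewrite ltr_wpDl.
pose r := e / (c0 + 1).
have r0 : 0 < r by rewrite divr_gt0.
pose kap := beta * Delta `^ (beta - 1) * (2 * r).
have kap0 : 0 <= kap by apply: mulr_ge0; apply: mulr_ge0; rewrite ?powR_ge0 ?(ltW r0).
have kapB : kap * B <= e.
  have -> : kap * B = c0 * r by rewrite /kap /c0; ring.
  by rewrite /r mulrA ler_pdivrMr// mulrC ler_wpM2l ?(ltW e0)// lerDl.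
have [] := @path_link R d beta Delta N K g W gamma rho k F _ Fcl FK klip
  rho_int rho_ftc rho_ae glen gstr kap kap0 r (ltW r0) erefl r0.
- exact: normr_ge0.
- by rewrite g0.
- by rewrite g1.
rewrite g0 g1 => n [C [L [ch Cle]]]; exists n, C, L; split => //.
apply: (le_trans Cle).
have mpw : measurable_fun [set: R] (fun t => path_weight (beta := beta) (g := g) gamma t).
  apply: continuous_measurable_fun.
  exact: (path_weight_continuous W gamma k (normr_ge0 _) klip).
rewrite /path_cost.
under eq_integral do rewrite mulrDl EFinD.
rewrite ge0_integralD//; last 4 first.
- by move=> t _; rewrite lee_fin mulr_ge0 ?powR_ge0 ?enorm_ge0.
- by apply/measurable_EFinP; apply: measurable_funTS; exact: measurable_funM.
- by move=> t _; rewrite lee_fin mulr_ge0 ?enorm_ge0.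
- by apply/measurable_EFinP; apply: measurable_funTS; exact: measurable_funM.
apply: leeD.
  rewrite (fdtm_lengthE dtmE); apply: ge0_le_integral_ae => //.
  - by apply/measurable_EFinP; apply: measurable_funTS; exact: measurable_funM.
  - by move=> t _; rewrite lee_fin mulr_ge0 ?powR_ge0 ?enorm_ge0.
  - by move=> t; rewrite lee_fin mulr_ge0 ?powR_ge0 ?enorm_ge0.
  move: rho_ae; apply: filterS; first exact: (ae_filter_ringOfSetsType leb).
  move=> t h; rewrite /= in_itv/= => t01; have [_ ->] := h t01.
  by rewrite /path_weight clamp_id.
have -> : (\int[leb]_(t in `[0%R, 1%R]) (kap * speed rho t)%:E)%E = (kap * B)%:E.
  rewrite -RintegralZl// /Rintegral fineK//; apply: integrable_fin_num => //.
  exact: integrable_scale.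
by rewrite lee_fin.
Qed.

Lemma fermat_le_chain (F : set 'rV[R]_d) x y n C L : chain F x y n C L ->
  (fermat_dtm m p beta mu F x y <= C%:E)%E.
Proof.
move=> /chain_vertices[v [n0 <- <- vF [-> _]]].
rewrite -(polygon_fdtm_length W dtmE n v n0); apply: ereal_inf_lbound.
by exists (polygon n v) => //; exact: polygon_Gamma.
Qed.

Lemma fermat_ge0 (F : set 'rV[R]_d) x y : (0 <= fermat_dtm m p beta mu F x y)%E.
Proof.
apply: le_ereal_inf_tmp => _ [gamma _ <-]; rewrite (fdtm_lengthE dtmE).
by apply: integral_ge0 => t _; rewrite lee_fin mulr_ge0 ?powR_ge0 ?enorm_ge0.
Qed.

(** The segment from x to y is an admissible path, of finite cost. *)
Lemma fermat_fin_num (F : set 'rV[R]_d) x y :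
  fermat_dtm m p beta mu F x y \is a fin_num.
Proof.
rewrite ge0_fin_numE ?fermat_ge0//.
by rewrite (le_lt_trans (fermat_le_chain _ _ _ _ _ _ (Chain1 F x y)))// ltry.
Qed.

Lemma fermat_le (F G : set 'rV[R]_d) (e : R) x y : closed F -> F `<=` K ->
  G `<=` K -> (forall z, F z -> exists2 z', G z' & enorm (z' - z) <= e) ->
  0 < e -> e <= 2 * Delta -> K x -> K y ->
  (fermat_dtm m p beta mu G x y <= fermat_dtm m p beta mu F x y +
   (transfer_const (beta := beta) (N := N) *
     (Delta `^ beta * Num.sqrt (Delta * e)))%:E)%E.
Proof.
move=> Fcl FK GK FG e0 eD Kx Ky; set T := _ * _.
rewrite -leeBlDr//; apply: le_ereal_inf_tmp => _ [gamma gam <-].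
apply/lee_addgt0Pr => eta eta0; rewrite leeBlDr//.
have [n [C [L [ch Cle]]]] := path_chain F x y gamma eta Fcl FK Kx Ky gam eta0.
have [n' [C' [L' [ch' C'le]]]] := chain_transfer W F G e x y n C L ch FK GK FG e0 eD Kx Ky.
apply: (le_trans (fermat_le_chain _ _ _ _ _ _ ch')).
apply: (@le_trans _ _ (C%:E + T%:E)%E); first by rewrite -EFinD lee_fin.
exact: leeD.
Qed.

End fermat_compare.

Section hausdorff.
Context {R : realType} {d : nat} (K F G : set 'rV[R]_d).
Hypotheses (K_compact : compact K) (F_K : F `<=` K) (G_K : G `<=` K).
Hypotheses (F_neq0 : F !=set0) (G_neq0 : G !=set0).

Lemma dist_to_ge0 (x : 'rV[R]_d) (A : set 'rV[R]_d) : A !=set0 -> 0 <= dist_to x A.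
Proof.
move=> [a Aa]; apply: lb_le_inf; first by exists (enorm (x - a)), a.
by move=> _ [z _ <-]; exact: enorm_ge0.
Qed.

Lemma dist_to_le_diam x : K x -> dist_to x G <= diam K.
Proof.
move=> Kx; have [z Gz] := G_neq0.
apply: (@le_trans _ _ (enorm (x - z))); last by apply: le_diam => //; exact: G_K.
apply: ge_inf; last by exists z.
by exists 0 => _ [w _ <-]; exact: enorm_ge0.
Qed.

Lemma dist_to_le_sup x : F x -> dist_to x G <= sup [set dist_to x G | x in F].
Proof.
move=> Fx; apply: ub_le_sup; last by exists x.
by exists (diam K) => _ [w Fw <-]; apply: dist_to_le_diam; exact: F_K.
Qed.

Lemma sup_dist_to_le_diam : sup [set dist_to x G | x in F] <= diam K.
Proof.
have [x Fx] := F_neq0; apply: ge_sup; first by exists (dist_to x G), x.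
by move=> _ [w Fw <-]; apply: dist_to_le_diam; exact: F_K.
Qed.

Lemma sup_dist_to_ge0 : 0 <= sup [set dist_to x G | x in F].
Proof.
have [x Fx] := F_neq0.
exact: le_trans (dist_to_ge0 x G G_neq0) (dist_to_le_sup x Fx).
Qed.

Lemma dist_to_witness (e : R) x : F x -> sup [set dist_to x G | x in F] < e ->
  exists2 z, G z & enorm (z - x) <= e.
Proof.
move=> Fx se; have dxe := le_lt_trans (dist_to_le_sup x Fx) se.
have ne : [set enorm (x - z) | z in G] !=set0.
  by have [z Gz] := G_neq0; exists (enorm (x - z)), z.
have [_ [z Gz <-] ze] := inf_lt ne dxe.
by exists z => //; rewrite enormC ltW.
Qed.

End hausdorff.

Section singleton_domain.
Context {R : realType} {d : nat} {m p beta : R}.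
Context {mu : probability (borel_rV R d) R}.

(** The constant path is never outside F. This covers the case where K is a
    single point, in particular the space of dimension 0, where no path that
    leaves F is admissible for lack of a unit vector. *)
Lemma fermat_same_point (F : set 'rV[R]_d) (x : 'rV[R]_d) : F x ->
  fermat_dtm m p beta mu F x x = 0%E.
Proof.
move=> Fx; apply/eqP; rewrite eq_le; apply/andP; split; last first.
  apply: le_ereal_inf_tmp => _ [gamma _ <-]; apply: integral_ge0 => t _.
  by rewrite mule_ge0 ?poweR_ge0// lee_fin enorm_ge0.
have d0 (t : R) : derive1 (cst x : R -> 'rV[R]_d) t = 0 by rewrite derive1E derive_cst.
apply: ereal_inf_lbound; exists (cst x); last first.
  by rewrite /fdtm_length integral0_eq// => t _; rewrite d0 enorm0 mule0.
split => //; last first.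
  by move=> a b a0 ab b1 /(_ ((a + b) / 2)) []//; rewrite in_itv/=; apply/andP; split; lra.
split.
- by apply: continuous_subspaceT => t; exact: cvg_cst.
- by exists 0 => s t _ _; rewrite subrr enorm0 mul0r.
- by rewrite /path_length integral0_eq// => t _; rewrite d0 enorm0.
Qed.

End singleton_domain.

Theorem theorem9 (R : realType) (m beta : R)
  (m_gt0 : 0 < m) (m_le1 : m <= 1) (beta_ge1 : 1 <= beta) :
  exists C : R, 0 < C /\
    forall (p : R) (d : nat) (K : set 'rV[R]_d)
      (mu : probability (borel_rV R d) R) (F G : set 'rV[R]_d),
      1 <= p ->
      compact K -> convex_set K ->
      measure_support mu `<=` K ->
      F !=set0 -> closed F -> F `<=` K ->
      G !=set0 -> closed G -> G `<=` K ->
      (ereal_sup [set `|fermat_dtm m p beta mu F x y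
                        - fermat_dtm m p beta mu G x y| | x in K & y in K]
       <= (C * diam K `^ (beta + 2^-1)
             * Num.sqrt (hausdorff_dist F G))%:E)%E.
Proof.
pose N := (Num.truncn (2 / m)).+1.
pose tc : R := transfer_const (beta := beta) (N := N).
exists (`|tc| + 1); split; first by rewrite ltr_wpDl.
move=> p d K mu F G p1 Kc Kconv sK F0 Fcl FK G0 Gcl GK.
have [x0 Fx0] := F0.
have K0 : K !=set0 by exists x0; exact: FK.
apply: ge_ereal_sup => _ [x Kx [y Ky <-]].
have D0 : 0 <= diam K by exact: diam_ge0.
have [Dz|Dnz] := eqVneq (diam K) 0.
  have Keq u w : K u -> K w -> u = w.
    move=> Ku Kw; apply/eqP; rewrite -subr_eq0; apply/eqP/enorm_eq0/eqP.
    by rewrite eq_le enorm_ge0 andbT -Dz le_diam.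
  have Fx : F x by rewrite (Keq x x0)//; exact: FK.
  have Gx : G x by have [z Gz] := G0; rewrite (Keq x z)//; exact: GK.
  rewrite (Keq y x)// !fermat_same_point// sube0 abse0 lee_fin.
  by rewrite !mulr_ge0 ?powR_ge0 ?sqrtr_ge0.
have Dgt0 : 0 < diam K by rewrite lt_neqAle eq_sym Dnz D0.
have ex_unit : exists u : 'rV[R]_d, enorm u = 1.
  apply: contrapT => nex; move/eqP : Dnz; apply; apply/eqP.
  rewrite eq_le D0 andbT; apply: ge_sup; first by exists (enorm (x - y)), x => //; exists y.
  move=> _ [u Ku [w Kw <-]]; have [->|uw] := eqVneq (u - w) 0.
    by rewrite enorm0.
  by exfalso; apply: nex; exact: unit_vector_exists uw.
pose g := dtmr m p mu.
have dtmE z : dtm m p mu z = (g z)%:E by exact: (dtm_fin m p mu K).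
have W : tame_weight beta (diam K) N K g.
  split => //.
  - by move=> z; exact: (dtmr_ge0 m p mu K).
  - by move=> z w; exact: (dtmr_lip m p mu K).
  - by move=> z; exact: (dtmr_le_diam m p mu K).
  - move=> u w s Ku Kw /andP[s0 s1].
    have := Kconv w u (Itv01 s0 s1); rewrite !inE => /(_ Kw Ku).
    congr K; rewrite /seg /conv /=; apply/rowP => i; rewrite !mxE /unstable.onem /=.
    by ring.
  - by move=> u w Ku Kw; exact: le_diam.
  - move=> r z r0 zsep; apply: contrapT => nex.
    have zr i : g (z i) < r.
      by rewrite ltNge; apply/negP => ri; apply: nex; exists i.
    have := dtmr_packing m p mu K m_gt0 m_le1 p1 Kc sK K0 N z r r0 zr zsep.
    apply/negP; rewrite -ltNge mulrA ltr_pdivlMr// mul1r -ltr_pdivrMr//.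
    exact: truncnS_gt.
set eps := hausdorff_dist F G.
have eF : sup [set dist_to x G | x in F] <= eps by rewrite le_max lexx.
have eG : sup [set dist_to x F | x in G] <= eps by rewrite le_max lexx orbT.
have eps0 : 0 <= eps := le_trans (sup_dist_to_ge0 K F G Kc FK GK F0 G0) eF.
have epsD : eps <= diam K.
  by rewrite ge_max !sup_dist_to_le_diam.
(* the infima in the Hausdorff distance are approached only up to some e > 0,
   which also keeps the scale of the coarsening positive if F = G *)
have close e : 0 < e -> e <= diam K ->
    (`|fermat_dtm m p beta mu F x y - fermat_dtm m p beta mu G x y| <=
     (tc * (diam K `^ beta * Num.sqrt (diam K * (eps + e))))%:E)%E.
  move=> e0 eD.
  have ee0 : 0 < eps + e by rewrite ltr_wpDl.
  have eeD : eps + e <= 2 * diam K by move: epsD eD; lra.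
  have lt_ee : eps < eps + e by rewrite ltrDl.
  have h1 := fermat_le W dtmE ex_unit F G (eps + e) x y Fcl FK GK
    (fun z Fz => dist_to_witness K F G Kc FK GK G0 _ z Fz (le_lt_trans eF lt_ee))
    ee0 eeD Kx Ky.
  have h2 := fermat_le W dtmE ex_unit G F (eps + e) x y Gcl GK FK
    (fun z Gz => dist_to_witness K G F Kc GK FK F0 _ z Gz (le_lt_trans eG lt_ee))
    ee0 eeD Kx Ky.
  have := fermat_fin_num W dtmE ex_unit F x y.
  have := fermat_fin_num W dtmE ex_unit G x y.
  move: h1 h2; rewrite -/tc.
  case: (fermat_dtm _ _ _ _ F _ _) => // a; case: (fermat_dtm _ _ _ _ G _ _) => // b.
  rewrite -!EFinD !lee_fin => h1 h2 _ _; rewrite ler_norml.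
  by move: h1 h2; move: (tc * _) => T; lra.
have target : `|tc| * (diam K `^ beta * Num.sqrt (diam K * eps)) <=
    (`|tc| + 1) * diam K `^ (beta + 2^-1) * Num.sqrt eps.
  rewrite (sqrtrM _ D0) -(powR12_sqrt D0) mulrA mulrA.
  rewrite -(mulrA _ (diam K `^ beta)) -powRD; last by rewrite Dnz implybT.
  apply: ler_wpM2r; first exact: sqrtr_ge0.
  by apply: ler_wpM2r; [exact: powR_ge0|rewrite lerDl].
apply/lee_addgt0Pr => eta eta0; pose M := `|tc| * diam K `^ beta + 1.
have M0 : 0 < M by rewrite ltr_wpDl// mulr_ge0// powR_ge0.
pose e := Num.min (diam K) ((eta / M) ^+ 2 / diam K).
have e0 : 0 < e by rewrite lt_min Dgt0 divr_gt0// exprn_gt0// divr_gt0.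
have eD : e <= diam K by rewrite ge_min lexx.
apply: (le_trans (close e e0 eD)); rewrite -EFinD lee_fin.
have sqrt_e : Num.sqrt (diam K * e) <= eta / M.
  have q0 : 0 <= eta / M by rewrite divr_ge0// ltW.
  rewrite -(ger0_norm q0) -sqrtr_sqr.
  by apply: ler_wsqrtr; rewrite mulrC -ler_pdivlMr// ge_min lexx orbT.
have sqrt_split : Num.sqrt (diam K * (eps + e)) <=
    Num.sqrt (diam K * eps) + Num.sqrt (diam K * e).
  have a0 : 0 <= diam K * eps by exact: mulr_ge0.
  have b0 : 0 <= diam K * e by rewrite mulr_ge0// ltW.
  have c0 : 0 <= Num.sqrt (diam K * eps) + Num.sqrt (diam K * e).
    by rewrite addr_ge0 ?sqrtr_ge0.
  rewrite -(ger0_norm c0) -sqrtr_sqr.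
  apply: ler_wsqrtr; rewrite sqrrD !sqr_sqrtr// mulrDr -addrA lerD2l lerDr.
  by rewrite mulrn_wge0// mulr_ge0 ?sqrtr_ge0.
have P0 : 0 <= `|tc| * diam K `^ beta by rewrite mulr_ge0 ?powR_ge0.
apply: (@le_trans _ _ (`|tc| * (diam K `^ beta * Num.sqrt (diam K * (eps + e))))).
  by rewrite ler_wpM2r ?ler_norm// mulr_ge0 ?powR_ge0 ?sqrtr_ge0.
rewrite mulrA; apply: (le_trans (ler_wpM2l P0 sqrt_split)).
rewrite mulrDr; apply: lerD; first by apply: le_trans target; rewrite mulrA.
apply: (@le_trans _ _ (M * (eta / M))); last by rewrite mulrC divfK// gt_eqF.
by apply: ler_pM => //; rewrite ?sqrtr_ge0// lerDl.
Qed.
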